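(* The number of non-isomorphic degree $8$ maximal arcs of proper Mathon type in $\mathrm{PG}(2,2^7)$ is equal to $201$; two of them are Singer $8$-arcs and $199$ of them are normal $8$-arcs.
   Context: Let $q=2^h$, $\mathrm{Tr}$ the absolute trace $\mathrm{GF}(q)\to\mathrm{GF}(2)$. A maximal arc of degree $d$ in $\mathrm{PG}(2,q)$ is a non-empty proper point set meeting every line in $0$ or $d$ points. For $\alpha,\beta\in\mathrm{GF}(q)$ with $\mathrm{Tr}(\alpha\beta)=1$ and $\lambda\in\mathrm{GF}(q)^*$ let $F_{\alpha,\beta,\lambda}=\{(x,y,z):\alpha x^2+xy+\beta y^2+\lambda z^2=0\}$. For $\lambda\ne\lambda'$ define $F_{\alpha,\beta,\lambda}\oplus F_{\alpha',\beta',\lambda'}=F_{\alpha'',\beta'',\lambda+\lambda'}$ with $\alpha''=(\alpha\lambda+\alpha'\lambda')/(\lambda+\lambda')$, $\beta''=(\beta\lambda+\beta'\lambda')/(\lambda+\lambda')$. If a set $\mathcal{C}$ of such conics is closed under $\oplus$ (of distinct members), the union of its conics with $(0,0,1)$ is a maximal arc of degree $|\mathcal{C}|+1$; any image of such an arc under a collineation is a maximal arc of Mathon type. It is of Denniston type if it is an image of one whose conics are all of the form $F_{\alpha,1,\lambda}$ for a fixed $\alpha$ with $\mathrm{Tr}(\alpha)=1$; it is of proper Mathon type if it is of Mathon type but not of Denniston type. Arcs are isomorphic if some element of $\mathrm{P\Gamma L}(3,q)$ maps one onto the other, and the automorphism group of an arc is its stabilizer in $\mathrm{P\Gamma L}(3,q)$.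 A Singer $8$-arc is a degree $8$ maximal arc of proper Mathon type in $\mathrm{PG}(2,2^7)$ whose automorphism group has order $14$; a normal $8$-arc is one whose automorphism group has order $2$. *)

(* Defs.v *)
From HB Require Import structures.
From mathcomp Require Import all_boot all_order all_algebra all_field.
Set Implicit Arguments. Unset Strict Implicit. Unset Printing Implicit Defensive.
Import GRing.Theory.
Local Open Scope ring_scope.

Section MaxArcs.
Variable F : finFieldType.

(* Vectors of F^3 as row vectors; a projective point is the set of nonzero
   multiples of a nonzero vector; a point set of PG(2,F) is represented by
   the (scalar-closed) set of nonzero vectors representing its points. *)
Definition vec := 'rV[F]_3.
Definition i0 : 'I_3 := @Ordinal 3 0 isT.
Definition i1 : 'I_3 := @Ordinal 3 1 isT.
Definition i2 : 'I_3 := @Ordinal 3 2 isT.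

Definition pt_of (x : vec) : {set vec} := [set c *: x | c in [set c : F | c != 0]].
Definition is_point (P : {set vec}) : bool := [exists x : vec, (x != 0) && (P == pt_of x)].

Definition proj_set (S : {set vec}) : bool :=
  (0 \notin S) && [forall x in S, forall c : F, (c != 0) ==> (c *: x \in S)].

Definition dotv (x l : vec) : F := \sum_i x 0 i * l 0 i.

(* maximal arc of degree d: non-empty proper point set meeting every line
   (line = {x | x.l = 0}, l <> 0) in 0 or d points (= d*(q-1) vectors) *)
Definition is_maxarc (d : nat) (S : {set vec}) : bool :=
  [&& proj_set S, S != set0, S != [set x : vec | x != 0] &
   [forall l : vec, (l != 0) ==>
     let k := #|[set x in S | dotv x l == 0]| in
     (k == 0%N) || (k == (d * (#|F| - 1))%N)]].

(* Collineations of PG(2,F): x |-> x^sigma * A with A invertible and sigma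
   a field automorphism (elements of GammaL(3,F)) *)
Definition is_fieldaut (s : {ffun F -> F}) : bool :=
  [&& injectiveb s,
      [forall x, forall y, (s (x + y) == s x + s y) && (s (x * y) == s x * s y)]
    & s 1 == 1].

Definition gl_elt := ('M[F]_3 * {ffun F -> F})%type.
Definition valid (p : gl_elt) : bool := (p.1 \in unitmx) && is_fieldaut p.2.
Definition act (p : gl_elt) (S : {set vec}) : {set vec} :=
  [set map_mx (fun a => p.2 a) x *m p.1 | x in S].

(* the element of PGammaL(3,F) induced by p, as a map on projective points *)
Definition pgl_of (p : gl_elt) : {ffun {set vec} -> {set vec}} :=
  [ffun P => if is_point P then act p P else P].

Definition isomorphic (S T : {set vec}) : bool :=
  [exists p : gl_elt, valid p && (act p S == T)].

Definition aut_group (S : {set vec}) : {set {ffun {set vec} -> {set vec}}} :=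
  [set pgl_of p | p in [set p : gl_elt | valid p && (act p S == S)]].

(* absolute trace GF(2^h) -> GF(2), values read in F *)
Definition trace (h : nat) (x : F) : F := \sum_(i < h) x ^+ (2 ^ i).

Definition triple := (F * F * F)%type.
Definition alpha (c : triple) := c.1.1.
Definition beta (c : triple) := c.1.2.
Definition lam (c : triple) := c.2.

Definition conic (c : triple) : {set vec} :=
  [set v : vec | (v != 0) &&
     (alpha c * v 0 i0 ^+ 2 + v 0 i0 * v 0 i1 + beta c * v 0 i1 ^+ 2
        + lam c * v 0 i2 ^+ 2 == 0)].

Definition conic_ok (h : nat) (c : triple) : bool :=
  (trace h (alpha c * beta c) == 1) && (lam c != 0).

Definition oplus (c c' : triple) : triple :=
  (((alpha c * lam c + alpha c' * lam c') / (lam c + lam c'),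
    (beta c * lam c + beta c' * lam c') / (lam c + lam c')),
   lam c + lam c').

(* closed under (+) of distinct members; (+) must be defined (lambda <> lambda') *)
Definition mathon_set (h : nat) (C : {set triple}) : bool :=
  [forall c in C, conic_ok h c] &&
  [forall c in C, forall c' in C,
     (c != c') ==> (lam c != lam c') && (oplus c c' \in C)].

Definition nucleus : vec := \row_i (if i == i2 then 1 else 0).

Definition mathon_arc (C : {set triple}) : {set vec} :=
  (\bigcup_(c in C) conic c) :|: pt_of nucleus.

Definition mathon_type (h : nat) (S : {set vec}) : bool :=
  [exists C : {set triple}, mathon_set h C &&
     [exists p : gl_elt, valid p && (act p (mathon_arc C) == S)]].

Definition denniston_type (h : nat) (S : {set vec}) : bool :=
  [exists C : {set triple}, [exists a : F, [&& mathon_set h C,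
     trace h a == 1, [forall c in C, (alpha c == a) && (beta c == 1)] &
     [exists p : gl_elt, valid p && (act p (mathon_arc C) == S)]]]].

Definition proper_mathon_arc (h d : nat) (S : {set vec}) : bool :=
  [&& is_maxarc d S, mathon_type h S & ~~ denniston_type h S].

Definition iso_classes (P : {set {set vec}}) : {set {set {set vec}}} :=
  [set [set T in P | isomorphic S T] | S in P].

Definition iso_classes_with (P : {set {set vec}}) (n : nat) :
  {set {set {set vec}}} :=
  [set [set T in P | isomorphic S T] | S in [set S in P | #|aut_group S| == n]].

End MaxArcs.

(* Main.v *)
(** Write q = 128, Tr for the absolute trace.  A Mathon set of seven conics is
    given by a 3-dimensional GF(2)-subspace A (the lambda's together with 0) and
    two additive functions lambda * alpha, lambda * beta on A, which are linearized
    polynomials of degree at most 4.  Hence alpha and beta have the form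
    a0 + a1 l + a2 l^3, and linear substitutions reduce a non-Denniston arc to
    alpha = 1 + u l + l^3, beta = 1.  The trace conditions then say that
    Tr(l^3 + u l) = 0 on A, so that A is totally isotropic for the alternating
    form Tr(l^2 m + l m^2) on GF(128); conversely every isotropic A admits such a
    u, unique up to isomorphism of the arc, and yields a maximal arc.

    A collineation between two arcs maps conics to conics, since two conics with
    more than four common points coincide.  Comparing coefficients in l, the
    arcs of A and V are isomorphic if and only if V is the image of A under a
    power of Frobenius, and the automorphism group of the arc of A has twice as
    many elements as the stabilizer of A in the Galois group, of order 7.

    There are 126 * 1860 / 168 = 1395 isotropic 3-spaces.  At most eight of them
    are Frobenius-stable (they are zero sets of x^8 + c2 x^4 + c1 x^2 + c0 x with
    c's in GF(2)), and their number is 1395 = 2 modulo 7, hence 2; the others form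
    1393 / 7 = 199 orbits. *)
From mathcomp Require Import all_boot all_order all_algebra all_fingroup all_solvable all_field.
From mathcomp Require Import ring zify.
Require Import Defs.
Set Implicit Arguments. Unset Strict Implicit. Unset Printing Implicit Defensive.
Import GRing.Theory.
Local Open Scope ring_scope.

Section Classification.
Variable F : finFieldType.
Hypothesis hF : #|F| = (2 ^ 7)%N.
Implicit Types (a b c k l m t u x y z : F) (A V : {set F}).

(** * Arithmetic of GF(128) and its absolute trace *)

Lemma even0 n : (n.*2)%:R = 0 :> F.
Proof.
have /(_ 2 7) := @card_finPcharP F; rewrite hF => /(_ erefl isT) /pcharf0 h2.
by rewrite -muln2 natrM h2 mulr0.
Qed.

(* [ring] replaces a coefficient only when it is literally the left-hand side
   of an equation it is given, so the even coefficients are listed. *)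
Fact e2 : 2 = 0 :> F. Proof. exact: even0 1. Qed.
Fact e4 : 4 = 0 :> F. Proof. exact: even0 2. Qed.
Fact e6 : 6 = 0 :> F. Proof. exact: even0 3. Qed.
Fact e8 : 8 = 0 :> F. Proof. exact: even0 4. Qed.
Fact e10 : 10 = 0 :> F. Proof. exact: even0 5. Qed.
Fact e12 : 12 = 0 :> F. Proof. exact: even0 6. Qed.
Fact e14 : 14 = 0 :> F. Proof. exact: even0 7. Qed.
Fact e16 : 16 = 0 :> F. Proof. exact: even0 8. Qed.
Fact e20 : 20 = 0 :> F. Proof. exact: even0 10. Qed.
Fact e24 : 24 = 0 :> F. Proof. exact: even0 12. Qed.

Lemma addxx x : x + x = 0.
Proof. by rewrite -mulr2n -mulr_natl e2 mul0r. Qed.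

Lemma oppx x : - x = x.
Proof. by apply/eqP; rewrite eq_sym -addr_eq0 addxx. Qed.

Lemma addx_eq0 x y : (x + y == 0) = (x == y).
Proof. by rewrite addr_eq0 oppx. Qed.

Lemma eq_add0 x y : x + y = 0 -> x = y.
Proof. by move=> /eqP; rewrite addx_eq0 => /eqP. Qed.

Lemma addxK x y : x + y + y = x.
Proof. by rewrite -addrA addxx addr0. Qed.

(* Once [x = y] is restated as [x + y = 0], monomials common to both sides get even coefficients,
   which the listed equations erase. *)
Tactic Notation "ring2" :=
  apply: eq_add0; ring: e2 e4 e6 e8 e10 e12 e14 e16 e20 e24.
Tactic Notation "ring2" ":" constr(H) :=
  apply: eq_add0; ring: e2 e4 e6 e8 e10 e12 e14 e16 e20 e24 H.
Tactic Notation "ring2" ":" constr(H) constr(H') :=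
  apply: eq_add0; ring: e2 e4 e6 e8 e10 e12 e14 e16 e20 e24 H H'.
Tactic Notation "field2" :=
  apply: eq_add0; field: e2 e4 e6 e8 e10 e12 e14 e16 e20 e24.
Tactic Notation "field2" ":" constr(H) :=
  apply: eq_add0; field: e2 e4 e6 e8 e10 e12 e14 e16 e20 e24 H.

Lemma sqrD x y : (x + y) ^+ 2 = x ^+ 2 + y ^+ 2.
Proof. by ring2. Qed.

Lemma frobD i x y : (x + y) ^+ (2 ^ i) = x ^+ (2 ^ i) + y ^+ (2 ^ i).
Proof. by elim: i => [|i IH]; rewrite ?expr1 // !expnSr !exprM IH sqrD. Qed.

Lemma expr128 x : x ^+ 128 = x.
Proof. by rewrite -[RHS]expf_card hF. Qed.

(** The power 64 is thus the square root of GF(128), and is used as such throughout. *)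
Lemma sqrtK x : (x ^+ 64) ^+ 2 = x.
Proof. by rewrite -exprM expr128. Qed.

Lemma sqr_inj x y : x ^+ 2 = y ^+ 2 -> x = y.
Proof.
by move=> h; apply: eq_add0; apply/eqP; rewrite -[_ == 0]sqrf_eq0 sqrD h addxx.
Qed.

Local Notation tr := (@trace F 7).

Lemma trE x : tr x =
  x + x ^+ 2 + x ^+ 4 + x ^+ 8 + x ^+ 16 + x ^+ 32 + x ^+ 64.
Proof. by rewrite /trace !big_ord_recr big_ord0 /= add0r. Qed.

Lemma trD x y : tr (x + y) = tr x + tr y.
Proof. by rewrite /trace -big_split; apply: eq_bigr => i _; exact: frobD. Qed.

Lemma tr_sqr x : tr (x ^+ 2) = tr x.
Proof. by rewrite !trE -!exprM !mulnE /= expr128; ring. Qed.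

Lemma tr0 : tr 0 = 0.
Proof. by rewrite trE !expr0n /= !addr0. Qed.

Lemma tr1 : tr 1 = 1.
Proof. by rewrite trE !expr1n; ring2. Qed.

Lemma tr_sum (I : Type) (r : seq I) (P : pred I) (f : I -> F) :
  tr (\sum_(i <- r | P i) f i) = \sum_(i <- r | P i) tr (f i).
Proof. exact: (big_morph _ trD tr0). Qed.

Lemma bit_of_sqr x : x ^+ 2 = x -> x = 0 \/ x = 1.
Proof.
move=> h; case: (eqVneq x 0) => [->|x0]; [by left | right].
by apply: (mulIf x0); rewrite mul1r -expr2.
Qed.

Lemma tr_bit x : tr x = 0 \/ tr x = 1.
Proof.
apply: bit_of_sqr; rewrite -[RHS]tr_sqr !trE !sqrD -!exprM.
by congr (_ + _ + _ + _ + _ + _ + _).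
Qed.

(** 3 is prime to 127: writing 128 = 3 * 42 + 2 in k^128 = k gives k^2 = k. *)
Lemma cube_inj1 k : k ^+ 3 = 1 -> k = 1.
Proof.
move=> k3; have /bit_of_sqr[k0|//] : k ^+ 2 = k.
  by rewrite -[RHS]expr128 (_ : 128 = 3 * 42 + 2)%N // exprD exprM k3 expr1n mul1r.
by move/eqP: k3; rewrite k0 expr0n eq_sym oner_eq0.
Qed.

(* 7 is odd, so the half-trace solves t^2 + t = x. *)
Lemma tr0_solve x : tr x = 0 -> exists t, t ^+ 2 + t = x.
Proof.
rewrite trE => h; exists (x + x ^+ 4 + x ^+ 16 + x ^+ 64).
rewrite !sqrD -!exprM !mulnE /= expr128 -[RHS]addr0 -[in RHS]h; ring2.
Qed.

Lemma tr_add_sqr t : tr (t ^+ 2 + t) = 0.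
Proof. by rewrite trD tr_sqr addxx. Qed.

(** If x is nonzero, multiplying the equation by b / x^2 gives a b = (b y / x)^2 + b y / x, an
    element of trace 0. *)
Lemma anisotropic a b x y : tr (a * b) = 1 ->
  a * x ^+ 2 + x * y + b * y ^+ 2 = 0 -> x = 0 /\ y = 0.
Proof.
move=> h q0.
have b0 : b != 0 by apply/eqP => b0; move/eqP: h; rewrite b0 mulr0 tr0 eq_sym oner_eq0.
case: (eqVneq x 0) => [x0 | x0].
  move/eqP: q0; rewrite x0 expr0n mulr0 mul0r !add0r mulf_eq0 (negPf b0) sqrf_eq0.
  by move/eqP.
have e : a * b = (b * y / x) ^+ 2 + b * y / x.
  have {}q0 : b * y ^+ 2 = a * x ^+ 2 + x * y.
    by apply: eq_add0; rewrite addrC.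
  rewrite expr2 (_ : b * y / x * (b * y / x) = b / x ^+ 2 * (b * y ^+ 2)).
    by rewrite q0; field2.
  by field.
by move/eqP: h; rewrite e tr_add_sqr eq_sym oner_eq0.
Qed.

(** This is how an identity in a parameter with more than four values becomes equations between
    coefficients; the degrees that occur never exceed 4. *)
Lemma quartic0 (T : {set F}) c0 c1 c2 c3 c4 : (4 < #|T|)%N ->
  {in T, forall t, c0 + c1 * t + c2 * t ^+ 2 + c3 * t ^+ 3 + c4 * t ^+ 4 = 0} ->
  [/\ c0 = 0, c1 = 0, c2 = 0, c3 = 0 & c4 = 0].
Proof.
move=> cT hT; pose p := Poly [:: c0; c1; c2; c3; c4].
have p0 : p = 0.
  apply: (roots_geq_poly_eq0 (rs := enum T)).
  - apply/allP => t; rewrite mem_enum => /hT ht; apply/rootP.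
    by rewrite horner_Poly /= mul0r add0r -[RHS]ht; ring.
  - exact: enum_uniq.
  - by rewrite -cardE; apply: leq_trans cT; apply: size_Poly.
have hp i : [:: c0; c1; c2; c3; c4]`_i = 0 by rewrite -coef_Poly -/p p0 coef0.
by split; [exact: (hp 0) | exact: (hp 1) | exact: (hp 2) | exact: (hp 3) | exact: (hp 4)].
Qed.

(** * Subspaces over GF(2) and linearized polynomials *)

Definition subsp V := (0 \in V) && [forall x in V, forall y in V, x + y \in V].

Lemma subspP V : reflect (0 \in V /\ {in V &, forall x y, x + y \in V}) (subsp V).
Proof.
apply: (iffP andP) => -[V0 h]; split=> //.
  by move=> x y Vx Vy; move/forall_inP: h => /(_ x Vx) /forall_inP /(_ y Vy).
by apply/forall_inP => x Vx; apply/forall_inP => y Vy; exact: h.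
Qed.

(** For a subspace V this is the span of V and l: the union of V and its coset V + l. *)
Definition ext V l := [set x | (x \in V) || (x + l \in V)].

Lemma subsp_addr V x y : subsp V -> y \in V -> (x + y \in V) = (x \in V).
Proof.
move=> /subspP[_ h] Vy; apply/idP/idP => Vx; last exact: h.
by rewrite -(addxK x y) h.
Qed.

Lemma subsp_ext V l : subsp V -> subsp (ext V l).
Proof.
move=> sV; have /subspP[V0 h] := sV; apply/subspP; rewrite inE V0; split=> // x y.
rewrite !inE => /orP[] hx /orP[] hy.
- by rewrite (h _ _ hx hy).
- by rewrite -addrA (h _ _ hx hy) orbT.
- by rewrite addrAC (h _ _ hx hy) orbT.
- by have := h _ _ hx hy; rewrite addrACA addxx addr0 => ->.
Qed.

Lemma sub_ext V l : V \subset ext V l.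
Proof. by apply/subsetP => x Vx; rewrite inE Vx. Qed.

Lemma mem_ext V l : subsp V -> l \in ext V l.
Proof. by case/subspP => V0 _; rewrite inE addxx V0 orbT. Qed.

Lemma ext_subset V l A : subsp A -> V \subset A -> l \in A -> ext V l \subset A.
Proof.
move=> /subspP[_ h] /subsetP sVA Al; apply/subsetP => x; rewrite inE.
by case/orP => /sVA // Ax; rewrite -(addxK x l) h.
Qed.

Lemma sum_ext (R : nmodType) V l (g : F -> R) : subsp V -> l \notin V ->
  \sum_(x in ext V l) g x = \sum_(x in V) (g x + g (x + l)).
Proof.
move=> sV Vl; rewrite big_split (bigID (mem V) (mem (ext V l))) /=; congr (_ + _).
  by apply: eq_bigl => x; rewrite inE; case: (x \in V); rewrite ?andbF ?andbT.
rewrite (reindex_inj (addIr l)); apply: eq_bigl => x /=.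
rewrite !inE addxK; case: (boolP (x \in V)) => Vx; rewrite ?orbT ?orbF.
  by rewrite addrC subsp_addr.
by rewrite andbN.
Qed.

Lemma card_ext V l : subsp V -> l \notin V -> #|ext V l| = #|V|.*2.
Proof.
by move=> sV Vl; rewrite -sum1_card sum_ext // -sum1_card -addnn -big_split.
Qed.

Definition sp1 l := ext [set 0] l.
Definition sp2 l m := ext (sp1 l) m.
Definition sp3 l m n := ext (sp2 l m) n.

Lemma subsp0 : subsp [set 0].
Proof.
by apply/subspP; rewrite inE; split=> // x y /set1P-> /set1P->; rewrite addr0 inE.
Qed.

Lemma subsp1 l : subsp (sp1 l). Proof. exact/subsp_ext/subsp0. Qed.
Lemma subsp2 l m : subsp (sp2 l m). Proof. exact/subsp_ext/subsp1. Qed.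
Lemma subsp3 l m n : subsp (sp3 l m n). Proof. exact/subsp_ext/subsp2. Qed.

(** Linear independence over GF(2). *)
Definition free3 l m n := [&& l != 0, m \notin sp1 l & n \notin sp2 l m].

Lemma card_sp1 l : l != 0 -> #|sp1 l| = 2%N.
Proof. by move=> l0; rewrite card_ext ?subsp0 ?inE // cards1. Qed.

Lemma card_sp2 l m : l != 0 -> m \notin sp1 l -> #|sp2 l m| = 4%N.
Proof. by move=> l0 lm; rewrite card_ext ?subsp1 // card_sp1. Qed.

Lemma card_sp3 l m n : free3 l m n -> #|sp3 l m n| = 8%N.
Proof. by case/and3P => l0 lm lmn; rewrite card_ext ?subsp2 // card_sp2. Qed.

Lemma sp3_subset l m n A : subsp A ->
  (sp3 l m n \subset A) = [&& l \in A, m \in A & n \in A].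
Proof.
move=> sA; apply/idP/and3P => [/subsetP h|[Al Am An]].
  split; apply: h; last exact/mem_ext/subsp2.
    exact/(subsetP (sub_ext _ _))/(subsetP (sub_ext _ _))/mem_ext/subsp0.
  exact/(subsetP (sub_ext _ _))/mem_ext/subsp1.
have /subspP[A0 _] := sA.
by do 3! [apply: ext_subset => //]; rewrite sub1set.
Qed.

Lemma sp3P l m n A : subsp A -> #|A| = 8 -> free3 l m n ->
  (sp3 l m n == A) = [&& l \in A, m \in A & n \in A].
Proof.
by move=> sA cA h; rewrite eqEcard card_sp3 // cA leqnn andbT sp3_subset.
Qed.

Lemma sum_sp3 (R : nmodType) l m n (g : F -> R) : free3 l m n ->
  \sum_(x in sp3 l m n) g x =
    g 0 + g n + (g m + g (m + n)) + (g l + g (l + n) + (g (l + m) + g (l + m + n))).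
Proof.
case/and3P => l0 lm lmn; rewrite sum_ext ?subsp2 // sum_ext ?subsp1 //.
by rewrite sum_ext ?subsp0 ?inE // big_set1 !add0r.
Qed.

Lemma out_of_card V A : (#|V| < #|A|)%N -> exists2 x, x \in A & x \notin V.
Proof.
move=> h; have /subsetPn : ~~ (A \subset V).
  by apply: contraL h => /subset_leq_card; rewrite -leqNgt.
by case=> x; exists x.
Qed.

Lemma basis A : subsp A -> #|A| = 8 -> exists l m n, free3 l m n /\ A = sp3 l m n.
Proof.
move=> sA cA.
have [|l Al l0] := @out_of_card [set 0] A; first by rewrite cards1 cA.
rewrite inE in l0.
have [|m Am m0] := @out_of_card (sp1 l) A; first by rewrite card_sp1 // cA.
have [|n An n0] := @out_of_card (sp2 l m) A; first by rewrite card_sp2 // cA.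
exists l, m, n; have fr : free3 l m n by rewrite /free3 l0 m0.
by split=> //; apply/esym/eqP; rewrite sp3P // Al Am.
Qed.

Definition additive_on A (f : F -> F) := {in A &, {morph f : x y / x + y}}.

Lemma additive_on0 A f : subsp A -> additive_on A f -> f 0 = 0.
Proof. by move=> /subspP[A0 _] /(_ _ _ A0 A0); rewrite addr0 -{1}[f 0]addr0 => /addrI. Qed.

(** The elements of A where f and g agree form a subspace, and it contains the basis l, m, n. *)
Lemma additive_eq A l m n f g : A = sp3 l m n ->
  additive_on A f -> additive_on A g ->
  f l = g l -> f m = g m -> f n = g n -> {in A, f =1 g}.
Proof.
move=> eA hf hg fl fm fn.
have sA : subsp A by rewrite eA subsp3.
have /subspP[A0 Ad] := sA.
have sK : subsp [set x in A | f x == g x].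
  apply/subspP; rewrite inE A0 (additive_on0 sA hf) (additive_on0 sA hg) eqxx.
  split=> // x y; rewrite !inE => /andP[Ax /eqP fx] /andP[Ay /eqP fy].
  by rewrite (Ad _ _ Ax Ay) hf // hg // fx fy eqxx.
have /subsetP sub : A \subset [set x in A | f x == g x].
  have := subxx A; rewrite {1}eA sp3_subset // => /and3P[Al Am An].
  by rewrite {1}eA sp3_subset // !inE Al Am An fl fm fn !eqxx.
by move=> x /sub; rewrite inE => /andP[_ /eqP].
Qed.

Definition lin c0 c1 c2 x := c0 * x + c1 * x ^+ 2 + c2 * x ^+ 4.

Lemma linD c0 c1 c2 : {morph lin c0 c1 c2 : x y / x + y}.
Proof. by move=> x y; rewrite /lin; ring2. Qed.

Lemma lin_coef0 A c0 c1 c2 : (4 < #|A|)%N -> {in A, forall x, lin c0 c1 c2 x = 0} ->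
  [/\ c0 = 0, c1 = 0 & c2 = 0].
Proof.
move=> cA h.
have [//|x Ax|//] := @quartic0 A 0 c0 c1 0 c2.
by rewrite -[RHS](h x Ax) /lin; ring.
Qed.

(** Evaluation at a basis maps coefficient triples to triples of values, both ranging over F^3. It
    is injective because a nonzero [lin] has at most four roots, hence it is onto. *)
Lemma linearized A f : subsp A -> #|A| = 8 -> additive_on A f ->
  exists c0 c1 c2, {in A, f =1 lin c0 c1 c2}.
Proof.
move=> sA cA; have [l [m [n [fr eA]]]] := basis sA cA => hf.
pose ev (c : F * F * F) := let: (c0, c1, c2) := c in
  (lin c0 c1 c2 l, lin c0 c1 c2 m, lin c0 c1 c2 n).
have ev_inj : injective ev.
  move=> [[c0 c1] c2] [[d0 d1] d2] [h1 h2 h3].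
  have [|x|] := @lin_coef0 A (c0 + d0) (c1 + d1) (c2 + d2).
  - by rewrite cA.
  - move=> Ax; have -> : lin (c0 + d0) (c1 + d1) (c2 + d2) x = lin c0 c1 c2 x + lin d0 d1 d2 x.
      by rewrite /lin; ring.
    apply/eqP; rewrite addx_eq0; apply/eqP; move: x Ax.
    by apply: (additive_eq eA) => // x y _ _; rewrite linD.
  - by move=> /eq_add0-> /eq_add0-> /eq_add0->.
have /codomP[[[c0 c1] c2] /= [h1 h2 h3]] := injF_onto ev_inj (f l, f m, f n).
exists c0, c1, c2; apply: (additive_eq eA) => // x y _ _; exact: linD.
Qed.

(** Translation by w exchanges the two fibres of f. *)
Lemma card_half V f : subsp V -> additive_on V f ->
  {in V, forall x, f x = 0 \/ f x = 1} -> (exists2 w, w \in V & f w = 1) ->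
  #|[set x in V | f x == 0]|.*2 = #|V| /\ #|[set x in V | f x == 1]|.*2 = #|V|.
Proof.
move=> sV fD fb [w Vw fw]; have /subspP[_ Vd] := sV.
have eqc : #|[set x in V | f x == 1]| = #|[set x in V | f x == 0]|.
  rewrite -[RHS](card_imset _ (addIr w)); apply: eq_card => x; rewrite !inE.
  apply/andP/imsetP => [[Vx /eqP fx] | [y]].
    exists (x + w); last by rewrite addxK.
    by rewrite inE Vd //= fD // fx fw addxx.
  by rewrite inE => /andP[Vy /eqP fy] ->; rewrite Vd // fD // fy fw add0r.
have cV : #|V| = addn #|[set x in V | f x == 0]| #|[set x in V | f x == 1]|.
  rewrite -(cardsID [set x | f x == 0]); congr (_ + _)%N; apply: eq_card => x; rewrite !inE //.
  rewrite andbC; case: (boolP (x \in V)) => //= Vx.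
  by case: (fb x Vx) => ->; rewrite eqxx ?(eq_sym 0) ?oner_eq0.
by rewrite cV eqc -!addnn.
Qed.

(** * Counting isotropic 3-dimensional subspaces *)

Lemma card_fibers (T U : finType) (D : {set T}) (g : T -> U) (k : nat) :
  {in D, forall i : T, #|[set j in D | g j == g i]| = k} -> #|D| = (#|g @: D| * k)%N.
Proof.
move=> h; rewrite -sum1_card (partition_big_imset g) /= -sum_nat_const.
apply: eq_bigr => _ /imsetP[i Di ->]; rewrite -(h i Di) -sum1_card.
by apply: eq_bigl => j; rewrite inE.
Qed.

Lemma card_triples (T : finType) (P : pred T) (Q : rel T) (R : T -> rel T) :
  #|[set t : T * T * T | [&& P t.1.1, Q t.1.1 t.1.2 & R t.1.1 t.1.2 t.2]]| =
  (\sum_(i | P i) \sum_(j | Q i j) #|[set k | R i j k]|)%N.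
Proof.
under [RHS]eq_bigr do under eq_bigr do rewrite -sum1_card.
rewrite pair_big_dep pair_big_dep -sum1_card; apply: eq_bigl => t.
by rewrite !inE andbA.
Qed.

(** The polar form of the quadratic form Tr(x^3), see [tr_cubeD]. *)
Definition br x y := tr (x ^+ 2 * y + x * y ^+ 2).

Lemma brC x y : br x y = br y x.
Proof. by rewrite /br; congr (tr _); ring. Qed.

Lemma br_xx x : br x x = 0.
Proof. by rewrite /br -exprSr -exprS addxx tr0. Qed.

Lemma tr_cubeD x y : tr ((x + y) ^+ 3) = tr (x ^+ 3) + tr (y ^+ 3) + br x y.
Proof. by rewrite /br -!trD; congr (tr _); ring2. Qed.

(** The element representing the functional [br x] through the trace: Tr(x y^2) = Tr(x^64 y), since
    Tr is invariant under square roots. *)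
Definition rad x := x ^+ 2 + x ^+ 64.

Lemma br_rad x y : br x y = tr (rad x * y).
Proof.
rewrite /br /rad mulrDl !trD; congr (_ + _).
by rewrite -[RHS]tr_sqr exprMn sqrtK.
Qed.

Lemma radD x y : rad (x + y) = rad x + rad y.
Proof. by rewrite /rad sqrD (frobD 6); ring. Qed.

(** Squaring x^2 = x^64 gives x^4 = x, so x is 0 or a cube root of unity. The radical of [br] is
    therefore {0, 1}. *)
Lemma rad_eq0 x : (rad x == 0) = (x == 0) || (x == 1).
Proof.
apply/idP/orP => [|[]/eqP->]; rewrite /rad ?expr0n ?addr0 // ?expr1n ?addxx //.
rewrite addx_eq0 => /eqP h.
have h4 : x ^+ 4 = x by rewrite -[RHS]sqrtK -h -exprM.
have /eqP : x * (x ^+ 3 + 1) = 0 by rewrite mulrDr mulr1 -exprS h4 addxx.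
by rewrite mulf_eq0 addx_eq0 => /orP[|/eqP/cube_inj1/eqP]; [left | right].
Qed.

Definition perp a := [set y | tr (a * y) == 0].
Definition bperp x := perp (rad x).

Lemma mem_bperp x y : (y \in bperp x) = (br x y == 0).
Proof. by rewrite inE br_rad. Qed.

Lemma bit_eq0 x : x = 0 \/ x = 1 -> (x != 0) = (x == 1).
Proof. by case=> ->; rewrite eqxx ?oner_eq0 // eq_sym oner_eq0. Qed.

Lemma tr_neq0 x : (tr x != 0) = (tr x == 1).
Proof. exact/bit_eq0/tr_bit. Qed.

Lemma subsp_perp a : subsp (perp a).
Proof.
apply/subspP; rewrite inE mulr0 tr0; split=> // x y; rewrite !inE => /eqP hx /eqP hy.
by rewrite mulrDr trD hx hy addr0.
Qed.

Lemma subspI V A : subsp V -> subsp A -> subsp (V :&: A).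
Proof.
move=> /subspP[V0 hV] /subspP[A0 hA]; apply/subspP; rewrite inE V0 A0.
by split=> // x y /setIP[? ?] /setIP[? ?]; rewrite inE hV // hA.
Qed.

Lemma card_perpI V a : subsp V -> (exists2 w, w \in V & tr (a * w) = 1) ->
  #|V :&: perp a|.*2 = #|V|.
Proof.
move=> sV hw; have [||<- _] := card_half (f := fun y => tr (a * y)) sV _ _ hw.
- by move=> x y _ _ /=; rewrite mulrDr trD.
- by move=> x _; exact: tr_bit.
by congr (_.*2); apply: eq_card => x; rewrite !inE.
Qed.

Lemma card_perp a : a != 0 -> #|perp a| = 64%N.
Proof.
move=> a0; have sT : subsp setT by apply/subspP; split=> [|x y _ _]; rewrite inE.
have := @card_perpI setT a sT; rewrite setTI cardsT hF => h.
by apply: double_inj; rewrite h //; exists a^-1; rewrite ?inE // mulfV // tr1.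
Qed.

(** Distinct nonzero elements give independent functionals. The witness is 1/b, 1/a + 1/b, 1/(a+b)
    or 1/(a+b) + 1/a, depending on the traces of a/b, b/a and a/(a+b). *)
Lemma perp_sep a b : a != 0 -> b != 0 -> a != b ->
  exists w, tr (a * w) = 0 /\ tr (b * w) = 1.
Proof.
move=> a0 b0 ab; have ab0 : a + b != 0 by rewrite addx_eq0.
have ha := mulfV a0; have hb := mulfV b0; have hab := mulfV ab0.
case: (tr_bit (a * b^-1)) => h1; first by exists b^-1; rewrite hb tr1.
case: (tr_bit (b * a^-1)) => h2.
  by exists (a^-1 + b^-1); rewrite !mulrDr !trD ha hb tr1 h1 h2 add0r addxx.
have : tr (a * (a + b)^-1) + tr (b * (a + b)^-1) = 1 by rewrite -trD -mulrDl hab tr1.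
case: (tr_bit (a * (a + b)^-1)) => h4; rewrite h4.
  by rewrite add0r => h3; exists (a + b)^-1.
rewrite -[RHS]addr0 => /addrI h3; exists ((a + b)^-1 + a^-1).
by rewrite !mulrDr !trD ha h2 h3 h4 tr1 add0r addxx.
Qed.

Lemma card_perp2 a b : a != 0 -> b != 0 -> a != b -> #|perp a :&: perp b| = 32%N.
Proof.
move=> a0 b0 ab; apply: double_inj; rewrite card_perpI ?subsp_perp //.
  by rewrite card_perp.
by have [w [w0 w1]] := perp_sep a0 b0 ab; exists w; rewrite // inE w0.
Qed.

Definition isot A := [&& subsp A, #|A| == 8%N & [forall x in A, A \subset bperp x]].

Lemma isotP A : reflect [/\ subsp A, #|A| = 8%N & {in A &, forall x y, br x y = 0}] (isot A).
Proof.
apply: (iffP and3P) => -[sA /eqP cA h]; split=> //.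
  by move=> x y Ax Ay; have /subsetP/(_ y Ay) := forall_inP h x Ax; rewrite mem_bperp => /eqP.
by apply/forall_inP => x Ax; apply/subsetP => y Ay; rewrite mem_bperp h.
Qed.

Lemma subsp_bperp x : subsp (bperp x).
Proof. exact: subsp_perp. Qed.

(** Testing a basis suffices because each [bperp] is a subspace; the diagonal values vanish as the
    form is alternating. *)
Lemma isot_sp3 l m n : free3 l m n ->
  isot (sp3 l m n) = [&& m \in bperp l, n \in bperp l & n \in bperp m].
Proof.
move=> fr; apply/isotP/and3P => [[sA _ h]|].
  have := subxx (sp3 l m n); rewrite [in X in X -> _]sp3_subset // => /and3P[Al Am An].
  by rewrite !mem_bperp !h.
rewrite !mem_bperp => -[/eqP lm /eqP ln /eqP mn].
split; rewrite ?subsp3 ?card_sp3 // => x y Ax.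
have sub z : br z l = 0 -> br z m = 0 -> br z n = 0 -> {in sp3 l m n, forall y, br z y = 0}.
  move=> zl zm zn t At; apply/eqP; rewrite -mem_bperp; move: t At; apply/subsetP.
  by rewrite sp3_subset ?subsp_bperp // !mem_bperp zl zm zn eqxx.
by apply: (sub x); rewrite brC; apply: (sub _) => //; rewrite ?br_xx // brC.
Qed.

Definition isots := [set A | isot A].

(** Ordered bases of isotropic 3-spaces, each condition being attached to the last vector it
    involves, so that the vectors can be counted one after another. *)
Definition itriples := [set t : F * F * F |
  [&& t.1.1 != 0, t.1.2 \in bperp t.1.1 :\: sp1 t.1.1 &
   t.2 \in (bperp t.1.1 :&: bperp t.1.2) :\: sp2 t.1.1 t.1.2]].

Lemma mem_itriples l m n :
  (l, m, n) \in itriples = free3 l m n && isot (sp3 l m n).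
Proof.
rewrite inE /=; rewrite [m \in _]in_setD [n \in _]in_setD [n \in _ :&: _]in_setI.
case: (boolP (free3 l m n)) => [fr | ].
  by rewrite isot_sp3 //; case/and3P: fr => l0 -> ->; rewrite [l == 0](negPf l0).
by apply: contraNF => /and3P[l0 /andP[h _] /andP[h' _]]; apply/and3P.
Qed.

(** Each space has 7 * 6 * 4 = 168 ordered bases. *)
Lemma card_isots_triples : #|itriples| = (#|isots| * 168)%N.
Proof.
pose g (t : F * F * F) := sp3 t.1.1 t.1.2 t.2.
have -> : isots = g @: itriples.
  apply/setP => A; rewrite inE; apply/idP/imsetP => [iA | [[[l m] n]]].
    have /isotP[sA cA _] := iA; have [l [m [n [fr eA]]]] := basis sA cA.
    by exists (l, m, n); rewrite // mem_itriples fr -eA.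
  by rewrite mem_itriples => /andP[_ iA] ->.
apply: card_fibers => -[[l m] n]; rewrite mem_itriples => /andP[_ iA].
rewrite /g /=; set A := sp3 l m n in iA *; have /isotP[sA cA _] := iA.
have -> : [set t in itriples | sp3 t.1.1 t.1.2 t.2 == A] =
    [set t : F * F * F | [&& t.1.1 \in A :\ 0, t.1.2 \in A :\: sp1 t.1.1 &
                             t.2 \in A :\: sp2 t.1.1 t.1.2]].
  apply/setP => -[[x y] z]; rewrite inE mem_itriples [RHS]inE /=.
  rewrite [x \in _]in_setD1 [y \in _]in_setD [z \in _]in_setD.
  case: (boolP (free3 x y z)) => [fr|] /=.
    transitivity (sp3 x y z == A); first by case: eqP => [->|_]; rewrite ?iA ?andbF.
    by rewrite sp3P //; case/and3P: fr => x0 -> ->; rewrite [x == 0](negPf x0).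
  by move=> h; apply/esym; apply: contraNF h => /and3P[/andP[h1 _] /andP[h2 _] /andP[h3 _]]; apply/and3P.
rewrite (card_triples [in A :\ (0 : F)] (fun x y => y \in A :\: sp1 x)
                     (fun x y z => z \in A :\: sp2 x y)).
transitivity (\sum_(x in A :\ 0%R) 24)%N; last first.
  rewrite sum_nat_const; have := cardsD1 0 A; rewrite cA.
  have /subspP[-> _] := sA => -[c7]; rewrite (_ : #|A :\ 0%R| = 7%N) //.
apply: eq_bigr => x; rewrite in_setD1 => /andP[x0 Ax].
have s1 : sp1 x \subset A.
  by apply: ext_subset => //; rewrite sub1set; have /subspP[] := sA.
transitivity (\sum_(y in A :\: sp1 x) 4)%N; last first.
  by rewrite sum_nat_const cardsDS // card_sp1 // cA.
apply: eq_bigr => y; rewrite in_setD => /andP[y1 Ay].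
have s2 : sp2 x y \subset A by apply: ext_subset.
by rewrite cardsE cardsDS // card_sp2 // cA.
Qed.

(* Given l, the vectors m of bperp l for which rad l and rad m are dependent
   are those of sp2 1 l; for l = 1 they fill bperp l = F. *)
Lemma card_itriples : #|itriples| = (126 * 1860)%N.
Proof.
rewrite (card_triples (fun x => x != 0) (fun x y => y \in bperp x :\: sp1 x)
   (fun x y z => z \in (bperp x :&: bperp y) :\: sp2 x y)).
have cT : #|[set: F]| = 128%N by rewrite cardsT hF.
have b1 : bperp 1 = setT.
  by apply/setP => x; rewrite !inE (eqP (_ : rad 1 == 0)) ?rad_eq0 ?eqxx ?orbT // mul0r tr0 eqxx.
have cb l : l != 0 -> l != 1 -> #|bperp l| = 64%N.
  by move=> l0 l1; rewrite card_perp // rad_eq0 negb_or l0.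
have inner l m : l != 0 -> m \notin sp1 l -> m \in bperp l ->
    #|[set z | z \in (bperp l :&: bperp m) :\: sp2 l m]| = (#|bperp l :&: bperp m| - 4)%N.
  move=> l0 ml lm; rewrite cardsE cardsDS ?card_sp2 //.
  have sI : subsp (bperp l :&: bperp m) by rewrite subspI ?subsp_bperp.
  apply: ext_subset => //; first apply: ext_subset => //.
  - by rewrite sub1set; case/subspP: sI.
  - by rewrite inE !mem_bperp br_xx brC -mem_bperp lm eqxx.
  - by rewrite inE lm mem_bperp br_xx eqxx.
have mem1 l m : (m \in sp1 l) = (m == 0) || (m == l) by rewrite !inE addx_eq0.
rewrite (bigD1 1) ?oner_neq0 //=.
(* For l = 1 the 126 admissible m each leave 64 - 4 choices for the third vector. *)
have -> : (\sum_(m in bperp 1%R :\: sp1 1%R)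
    #|[set z | z \in (bperp 1%R :&: bperp m) :\: sp2 1%R m]| = 126 * 60)%N.
  rewrite (eq_bigr (fun=> 60%N)).
    rewrite sum_nat_const b1 setTD -(@card_sp1 1) ?oner_neq0 //.
    by congr (_ * _)%N; apply/eqP; rewrite -(eqn_add2l #|sp1 1|) cardsC hF card_sp1 ?oner_neq0.
  move=> m; rewrite in_setD => /andP[m1 bm]; rewrite inner ?oner_neq0 // b1 setTI.
  by move: m1; rewrite mem1 negb_or => /andP[m0 m1]; rewrite cb.
(* Each other l contributes 1800 = 60 + 60 + 60 * 28: for m = 1 and m = l + 1 there remain the 64 -
   4 vectors of [bperp l], for each of the 60 other m there remain 32 - 4. *)
rewrite (eq_bigr (fun=> 1800%N)).
  have -> : (\sum_(l : F | (l != 0%R) && (l != 1%R)) 1800 = 126 * 1800)%N => [|//].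
  rewrite sum_nat_const; congr (_ * _)%N.
  transitivity #|~: sp1 (1 : F)|.
    by apply: eq_card => l; rewrite in_setC mem1 negb_or.
  by apply/eqP; rewrite -(eqn_add2l #|sp1 1|) cardsC hF card_sp1 ?oner_neq0.
move=> l /andP[l0 l1].
have h1 : 1 \notin sp1 l by rewrite mem1 negb_or oner_neq0 eq_sym.
have h1' : l + 1 \notin sp1 l.
  by rewrite mem1 negb_or addx_eq0 l1 -{2}[l]addr0 (inj_eq (addrI l)) oner_neq0.
have hb1 : 1 \in bperp l by rewrite mem_bperp brC -mem_bperp b1 inE.
have hbl : l \in bperp l by rewrite mem_bperp br_xx.
have sb := subsp_bperp l; have /subspP[_ bD] := sb.
rewrite (bigD1 1) /=; last by rewrite in_setD h1.
rewrite (bigD1 (l + 1)) /=; last first.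
  by rewrite in_setD h1' bD //= -{2}[1]add0r (inj_eq (addIr 1)).
rewrite inner // b1 setIT cb // inner ?bD //.
have -> : bperp (l + 1) = bperp l.
  by rewrite /bperp radD (eqP (_ : rad 1 == 0)) ?rad_eq0 ?eqxx ?orbT // addr0.
rewrite setIid cb // (eq_bigr (fun=> 28%N)).
  rewrite sum_nat_const.
  have -> : #|[pred m | (m \in bperp l :\: sp1 l) && (m != 1) && (m != l + 1)]| = 60%N.
    transitivity #|bperp l :\: sp2 l 1|.
      apply: eq_card => m; rewrite [in RHS]in_setD [m \in sp2 _ _]inE negb_or.
      have e : (m + 1 == l) = (m == l + 1) by rewrite -(inj_eq (addIr 1)) addxK.
      rewrite inE in_setD !mem1 !negb_or addx_eq0 e.
      by do ![case: (_ == _)]; rewrite ?andbF ?andbT.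
    rewrite cardsDS ?cb ?card_sp2 //.
    by do 2 ! [apply: ext_subset => //]; rewrite sub1set; case/subspP: sb.
  by [].
move=> m /andP[/andP[]]; rewrite in_setD => /andP[]; rewrite mem1 negb_or => /andP[m0 ml] bm m1 ml1.
rewrite inner ?mem1 ?negb_or ?m0 // card_perp2 // ?rad_eq0 ?negb_or ?l0 ?m0 //.
rewrite -addx_eq0 -radD rad_eq0 negb_or addx_eq0 eq_sym ml /=.
by apply: contra ml1 => /eqP h; rewrite -h addrA addxx add0r.
Qed.

Lemma card_isots : #|isots| = 1395%N.
Proof.
have := card_isots_triples; rewrite card_itriples; lia.
Qed.

(** * Frobenius orbits on isotropic subspaces *)

Definition frob i A := [set x ^+ (2 ^ i) | x in A].

Lemma expr_frob_inj i : injective (fun x => x ^+ (2 ^ i)).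
Proof.
elim: i => [|i IH] x y; first by rewrite !expr1.
by rewrite /= !expnSr !exprM => /sqr_inj /IH.
Qed.

Lemma mem_frob i x A : (x ^+ (2 ^ i) \in frob i A) = (x \in A).
Proof. exact/mem_imset/expr_frob_inj. Qed.

Lemma frobM i j A : frob j (frob i A) = frob (i + j) A.
Proof.
rewrite /frob -imset_comp; apply: eq_imset => x /=.
by rewrite -exprM -expnD.
Qed.

Lemma expr_frob7 n i x : x ^+ (2 ^ (7 * n + i)) = x ^+ (2 ^ i).
Proof.
elim: n => [//|n IH]; rewrite mulnS -addnA expnD exprM.
by rewrite [_ ^+ (2 ^ 7)]expr128.
Qed.

Lemma expr_frob_mod i x : x ^+ (2 ^ (i %% 7)) = x ^+ (2 ^ i).
Proof. by rewrite [in RHS](divn_eq i 7) mulnC expr_frob7. Qed.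

Lemma frob_mod i A : frob (i %% 7) A = frob i A.
Proof. by apply: eq_imset => x; rewrite expr_frob_mod. Qed.

Lemma frob0 A : frob 0 A = A.
Proof. by rewrite -[RHS]imset_id; apply: eq_imset => x; rewrite expr1. Qed.

Lemma isot_frob i A : isot A -> isot (frob i A).
Proof.
move=> /isotP[sA cA h]; have /subspP[A0 AD] := sA; apply/isotP; split.
- apply/subspP; split; first by apply/imsetP; exists 0; rewrite // expr0n expn_eq0.
  move=> _ _ /imsetP[x Ax ->] /imsetP[y Ay ->]; rewrite -frobD.
  by apply: imset_f; exact: AD.
- by rewrite card_imset //; exact: expr_frob_inj.
move=> _ _ /imsetP[x Ax ->] /imsetP[y Ay ->].
elim: i => [|i IH]; first by rewrite !expr1 h.
by rewrite expnSr !exprM -[RHS]IH /br -[RHS]tr_sqr sqrD !exprMn.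
Qed.

(* Some multiple of i is 1 modulo 7. *)
Lemma frob_fix i A : (0 < i < 7)%N -> frob i A = A -> frob 1 A = A.
Proof.
move=> hi fA; have h n : frob (n * i) A = A.
  by elim: n => [|n IH]; rewrite ?frob0 // mulSn -frobM fA.
have [n hn] : exists n, ((n * i) %% 7 = 1)%N.
  by case: i hi {fA h} => [|[|[|[|[|[|[|//]]]]]]] // _;
     [exists 1%N | exists 4%N | exists 5%N | exists 2%N | exists 3%N | exists 6%N].
by rewrite -[RHS](h n) -[RHS]frob_mod hn.
Qed.

(** Applying [frob (7 - i)] to both sides shows that [frob (j - i)] fixes A, which [frob_fix] rules
    out for i < j. *)
Lemma frob_eq (i j : 'I_7) A : frob 1 A != A -> frob i A = frob j A -> i = j.
Proof.
move=> fA; wlog ij : i j / (i <= j)%N.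
  by move=> h e; case/orP: (leq_total i j) => ?; [exact: h | exact/esym/h].
move=> e; apply/val_inj/eqP; rewrite eqn_leq ij /= leqNgt; apply: contra fA => lt.
apply/eqP/(@frob_fix (j - i)); first by rewrite subn_gt0 lt (leq_ltn_trans (leq_subr _ _)).
have: frob (7 - i) (frob i A) = frob (7 - i) (frob j A) by rewrite e.
rewrite !frobM subnKC 1?ltnW // -frob_mod frob0 => {2}->.
rewrite -[RHS]frob_mod; have -> : (j + (7 - i) = (j - i) + 7)%N by have := ltn_ord i; lia.
by rewrite modnDr frob_mod.
Qed.

Definition fisots := [set A in isots | frob 1 A == A].

(* A Frobenius-stable A is the zero set of x^8 = c0 x + c1 x^2 + c2 x^4 with the
   c's in GF(2). *)
Lemma card_fisots_le : (#|fisots| <= 8)%N.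
Proof.
pose bit (b : bool) : F := if b then 1 else 0.
pose Z (b : bool * bool * bool) :=
  [set x | x ^+ 8 == lin (bit b.1.1) (bit b.1.2) (bit b.2) x].
suff sub : fisots \subset [set Z b | b in [set: bool * bool * bool]].
  apply: leq_trans (subset_leq_card sub) _; apply: leq_trans (leq_imset_card _ _) _.
  by rewrite cardsT !card_prod card_bool.
apply/subsetP => A; rewrite !inE => /andP[/isotP[sA cA _] /eqP fA].
have hA : additive_on A (fun x => x ^+ 8) by move=> x y _ _; exact: (frobD 3).
have [c0 [c1 [c2 hc]]] := linearized sA cA hA.
have fixA x : x \in A -> x ^+ 2 \in A by move=> Ax; rewrite -fA (mem_frob 1).
have bitE c : c ^+ 2 = c -> {b | c = bit b}.
  move=> h; case: (eqVneq c 0) => [->|c0']; first by exists false.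
  by exists true; case: (bit_of_sqr h) => // /eqP; rewrite (negPf c0').
(* Squaring the identity at y and comparing with the identity at y^2, again in A, shows that the c's
   and their squares define the same map. *)
have [h0 h1 h2] : [/\ c0 ^+ 2 + c0 = 0, c1 ^+ 2 + c1 = 0 & c2 ^+ 2 + c2 = 0].
  apply: (@lin_coef0 A); rewrite ?cA // => x; rewrite -fA => /imsetP[y Ay ->].
  have e : lin c0 c1 c2 y ^+ 2 = lin c0 c1 c2 (y ^+ 2).
    by rewrite -!hc ?fixA // -!exprM.
  rewrite -[y ^+ (2 ^ 1)]/(y ^+ 2) -[RHS](addxx (lin c0 c1 c2 y ^+ 2)) [X in _ = _ + X]e /lin.
  by ring2.
have [b0 e0] := bitE _ (eq_add0 h0); have [b1 e1] := bitE _ (eq_add0 h1).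
have [b2 e2'] := bitE _ (eq_add0 h2).
apply/imsetP; exists (b0, b1, b2); rewrite ?inE //; apply/eqP.
rewrite eqEcard; apply/andP; split.
  by apply/subsetP => x Ax; rewrite inE hc //= e0 e1 e2'.
(* Having at most eight roots, p vanishes nowhere outside the eight elements of A. *)
pose p := Poly [:: 0; c0; c1; 0; c2; 0; 0; 0; 1].
have p0 : p != 0.
  by apply/eqP => /polyP/(_ 8); rewrite coef_Poly coef0 => /eqP; rewrite oner_eq0.
rewrite cA -ltnS cardE; apply: leq_trans (size_Poly _ : (size p <= 9)%N).
apply: max_poly_roots p0 _ (enum_uniq _).
apply/allP => x; rewrite mem_enum inE /= -e0 -e1 -e2' => /eqP hx.
apply/rootP; rewrite horner_Poly /= -[RHS](addxx (x ^+ 8)) [X in _ = _ + X]hx /lin; ring.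
Qed.

(** Here g is any map whose fibres on [isots] are the Frobenius orbits; it will send A to the
    isomorphism class of its arc. Fibres have one element on [fisots] and seven elsewhere. *)
Lemma card_classes (T : finType) (g : {set F} -> T) :
  {in isots &, forall A B, (g A == g B) = [exists i : 'I_7, B == frob i A]} ->
  [/\ #|g @: isots| = 201%N, #|g @: fisots| = 2%N & #|g @: (isots :\: fisots)| = 199%N].
Proof.
move=> hg.
have subf : fisots \subset isots by apply/subsetP => A; rewrite inE => /andP[].
have fixi A i : frob 1 A = A -> frob i A = A.
  by move=> fA; elim: i => [|i IH]; rewrite ?frob0 // -addn1 -frobM IH.
have inj0 : {in fisots &, injective g}.
  move=> A B; rewrite !inE => /andP[iA /eqP fA] /andP[iB _] /eqP.
  by rewrite hg ?inE // => /existsP[i /eqP->]; rewrite fixi.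
have c1 : #|isots :\: fisots| = (#|g @: (isots :\: fisots)| * 7)%N.
  apply: card_fibers => A; rewrite !inE => /andP[fA iA]; rewrite iA /= in fA.
  transitivity #|[set frob (i : 'I_7) A | i in [set: 'I_7]]|.
    apply: eq_card => B; rewrite !inE; apply/idP/imsetP.
      case/andP => /andP[_ iB] e; move: e; rewrite eq_sym hg ?inE //.
      by case/existsP => i /eqP ->; exists i.
    case=> i _ ->; have iB := isot_frob i iA; rewrite iB andbT [g _ == _]eq_sym hg ?inE //=.
    apply/andP; split; last by apply/existsP; exists i.
    apply: contra fA => /eqP /(congr1 (frob (7 - i))); rewrite !frobM.
    have -> : (i + (1 + (7 - i)) = 7 * 1 + 1)%N by have := ltn_ord i; lia.
    rewrite subnKC 1?ltnW // -(frob_mod 7) frob0 => e.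
    by apply/eqP; rewrite -[RHS]e -[RHS]frob_mod.
  rewrite card_imset ?cardsT ?card_ord // => i j; exact: frob_eq.
have c0 := card_fisots_le.
have cs := cardsDS subf; rewrite card_isots c1 in cs.
(* 1395 = 7 * 199 + 2, and 2 is the only number up to 8 in this residue class modulo 7. *)
have c2 : #|fisots| = 2%N by lia.
have d : [disjoint g @: fisots & g @: (isots :\: fisots)].
  rewrite -setI_eq0; apply/eqP/setP => y; rewrite [RHS]inE; apply/negbTE/negP.
  case/setIP => /imsetP[A fA ->] /imsetP[B]; rewrite !inE in fA *.
  case/andP: fA => iA /eqP fA /andP[nB iB] /eqP; rewrite hg ?inE //.
  case/existsP => i /eqP eB; move/negP: nB; case.
  by rewrite eB (fixi A i fA) iA; apply/eqP.
have c3 : #|g @: (isots :\: fisots)| = 199%N by lia.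
split=> //; last by rewrite card_in_imset.
have -> : g @: isots = g @: fisots :|: g @: (isots :\: fisots).
  by rewrite -imsetU -[in RHS](setIidPr subf) setDIr setDv set0U setID.
rewrite cardsU.
have /eqP-> : g @: fisots :&: g @: (isots :\: fisots) == set0 by rewrite setI_eq0.
by rewrite c3 card_in_imset // c2 cards0.
Qed.

(** * Semilinear maps *)

Definition sg (i : nat) : {ffun F -> F} := [ffun x => x ^+ (2 ^ i)].

Lemma fieldaut_sg i : is_fieldaut (sg i).
Proof.
apply/and3P; split.
- by apply/injectiveP => x y; rewrite !ffunE; exact: expr_frob_inj.
- by apply/forallP => x; apply/forallP => y; rewrite !ffunE frobD exprMn !eqxx.
by rewrite ffunE expr1n.
Qed.

Lemma prim_root : exists g : F, forall x, x != 0 -> exists n, x = g ^+ n.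
Proof.
have /cyclicP[u hu] := field_unit_group_cyclic [set: {unit F}]%G.
exists (val u) => x x0; have xU : x \is a GRing.unit by rewrite unitfE.
have : FinRing.unit F xU \in <[u]>%g by rewrite -hu inE.
by case/cycleP => n /(congr1 val) /= ->; exists n; rewrite FinRing.val_unitX.
Qed.

(* The coefficients of prod_i (X - g^(2^i)) are fixed by squaring, hence by s,
   so that s permutes its roots. *)
Lemma fieldaut_is_sg s : is_fieldaut s -> exists2 i, (i < 7)%N & s = sg i.
Proof.
case/and3P => _ /forallP sH /eqP s1.
have sD x y : s (x + y) = s x + s y by have /forallP/(_ y)/andP[/eqP] := sH x.
have sM x y : s (x * y) = s x * s y by have /forallP/(_ y)/andP[_ /eqP] := sH x.
have s0 : s 0 = 0 by apply: (addrI (s 0)); rewrite -sD !addr0.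
have sX x n : s (x ^+ n) = s x ^+ n by elim: n => [|n IH]; rewrite ?expr0 // !exprS sM IH.
have [g hg] := prim_root.
pose f i := g ^+ (2 ^ i).
pose m := \prod_(i < 7) ('X - (f i)%:P).
have m_sqr i : m`_i ^+ 2 = m`_i.
  have e2P : (2 \in [pchar F])%R by rewrite inE /= e2.
  rewrite -[_ ^+ 2]/(pFrobenius_aut e2P m`_i) -coef_map /=; congr (polyseq _)`_i.
  rewrite /m rmorph_prod /=.
  under eq_bigr => j _ do rewrite rmorphB /= map_polyX map_polyC /= pFrobenius_autE -exprM -expnSr.
  (* Squaring shifts the factors cyclically: the last one on the left is the first one on the right,
     as [f 7] equals [f 0]. *)
  rewrite [LHS]big_ord_recr [RHS]big_ord_recl /= mulrC; congr (_ * _).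
    by rewrite /f expr1 expr128.
have root_sg : m.[s g] = 0.
  have -> : m.[s g] = s m.[g].
    rewrite !horner_coef (big_morph s sD s0); apply: eq_bigr => i _.
    by rewrite sM sX; case: (bit_of_sqr (m_sqr i)) => ->; rewrite ?s0 ?s1.
  rewrite /m horner_prod big_ord_recl /= hornerXsubC /f expr1 subrr mul0r; exact: s0.
move/eqP: root_sg; rewrite /m horner_prod prodf_seq_eq0 => /hasP[i _].
rewrite hornerXsubC subr_eq0 => /eqP si; exists i => //.
apply/ffunP => x; rewrite ffunE; case: (eqVneq x 0) => [->|/hg[n ->]].
  by rewrite s0 expr0n expn_eq0.
by rewrite sX si -!exprM mulnC.
Qed.

Lemma valid_sg p : valid p -> exists2 i, (i < 7)%N & p = (p.1, sg i).
Proof. by case: p => M s /andP[_ /= /fieldaut_is_sg[i hi ->]]; exists i. Qed.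

Implicit Types (v w : vec F) (S T : {set vec F}) (p q r : gl_elt F) (C D : {set triple F}).

Definition sl p v : vec F := map_mx (fun a => p.2 a) v *m p.1.

Lemma actE p S : act p S = [set sl p v | v in S]. Proof. by []. Qed.

Lemma sum3 (R : nmodType) (f : 'I_3 -> R) : \sum_i f i = f i0 + f i1 + f i2.
Proof.
rewrite !big_ord_recl big_ord0 addr0 addrA.
by congr (f _ + f _ + f _); apply: val_inj.
Qed.

Lemma slE p v j : sl p v 0 j =
  p.2 (v 0 i0) * p.1 i0 j + p.2 (v 0 i1) * p.1 i1 j + p.2 (v 0 i2) * p.1 i2 j.
Proof. by rewrite mxE sum3 !mxE. Qed.

Lemma frob_sum i (I : Type) (s : seq I) (P : pred I) (f : I -> F) :
  (\sum_(j <- s | P j) f j) ^+ (2 ^ i) = \sum_(j <- s | P j) f j ^+ (2 ^ i).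
Proof. by apply: (big_morph _ (frobD i)); rewrite expr0n expn_eq0. Qed.

Definition frmx i (m n : nat) (M : 'M[F]_(m, n)) := map_mx (fun a => a ^+ (2 ^ i)) M.

Lemma frmxM i (m n k : nat) (M : 'M_(m, n)) (N : 'M_(n, k)) :
  frmx i (M *m N) = frmx i M *m frmx i N.
Proof.
apply/matrixP => a b; rewrite !mxE frob_sum; apply: eq_bigr => c _.
by rewrite !mxE exprMn.
Qed.

Lemma frmx_unit i (n : nat) (M : 'M[F]_n) : M \in unitmx -> frmx i M \in unitmx.
Proof.
move=> /mulmxV h; suff : frmx i M *m frmx i (invmx M) = 1%:M by case/mulmx1_unit.
rewrite -frmxM h; apply/matrixP => a b; rewrite !mxE.
by case: (a == b); rewrite ?expr1n ?expr0n ?expn_eq0.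
Qed.

Lemma frmx_frmx i j (m n : nat) (M : 'M_(m, n)) : frmx j (frmx i M) = frmx (i + j) M.
Proof. by apply/matrixP => a b; rewrite !mxE -exprM -expnD. Qed.

Lemma frmx_mod i (m n : nat) (M : 'M_(m, n)) : frmx (i %% 7) M = frmx i M.
Proof. by apply/matrixP => a b; rewrite !mxE expr_frob_mod. Qed.

Lemma frmx0 (m n : nat) (M : 'M_(m, n)) : frmx 0 M = M.
Proof. by apply/matrixP => a b; rewrite !mxE expr1. Qed.

Lemma sl_sg (M : 'M[F]_3) i v : sl (M, sg i) v = frmx i v *m M.
Proof. by congr (_ *m _); apply/matrixP => a b; rewrite !mxE ffunE. Qed.

Lemma valid_mk (M : 'M[F]_3) i : M \in unitmx -> valid (M, sg i).
Proof. by move=> hM; rewrite /valid hM fieldaut_sg. Qed.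

Lemma sl_id v : sl (1%:M, sg 0) v = v.
Proof. by rewrite sl_sg mulmx1 frmx0. Qed.

Lemma sl_comp p q : valid p -> valid q -> exists2 r, valid r & sl r =1 sl q \o sl p.
Proof.
move=> vp vq; have [i _ ep] := valid_sg vp; have [j _ eq] := valid_sg vq.
move: vp vq => /andP[Mp _] /andP[Mq _].
exists (frmx j p.1 *m q.1, sg (i + j)).
  by rewrite valid_mk // unitmx_mul frmx_unit.
by move=> v /=; rewrite ep eq !sl_sg /= frmxM frmx_frmx mulmxA.
Qed.

Lemma sl_inv p : valid p ->
  exists r, [/\ valid r, cancel (sl p) (sl r) & cancel (sl r) (sl p)].
Proof.
move=> vp; have [i hi ep] := valid_sg vp; case/andP: vp => Mp _.
have canr : cancel (sl p) (sl (frmx (7 - i) (invmx p.1), sg (7 - i))).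
  move=> v; rewrite ep !sl_sg /= -frmxM -mulmxA mulmxV // mulmx1 frmx_frmx.
  by rewrite subnKC 1?ltnW // -frmx_mod frmx0.
exists (frmx (7 - i) (invmx p.1), sg (7 - i)); split=> //.
  by rewrite valid_mk // frmx_unit // unitmx_inv.
exact: (canF_sym canr).
Qed.

Lemma sl_inj p : valid p -> injective (sl p).
Proof. by case/sl_inv => r [_ /can_inj]. Qed.

Lemma sl0 p : valid p -> sl p 0 = 0.
Proof.
case/valid_sg => i _ ->; rewrite sl_sg (_ : frmx i 0 = 0) ?mul0mx //.
by apply/matrixP => a b; rewrite !mxE expr0n expn_eq0.
Qed.

Lemma sl_eq0 p v : valid p -> (sl p v == 0) = (v == 0).
Proof. by move=> vp; rewrite -{1}(sl0 vp) (inj_eq (sl_inj vp)). Qed.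

Lemma mem_act p v S : valid p -> (sl p v \in act p S) = (v \in S).
Proof. by move=> vp; exact/mem_imset/sl_inj. Qed.

Lemma act_comp p q r S : sl r =1 sl q \o sl p -> act r S = act q (act p S).
Proof. by move=> h; rewrite !actE -imset_comp; exact: eq_imset. Qed.

Lemma isoP S T : reflect (exists2 p, valid p & act p S = T) (isomorphic S T).
Proof.
by apply: (iffP existsP) => -[p]; [case/andP => ? /eqP|move=> ? /eqP ?]; exists p => //; apply/andP.
Qed.

Lemma iso_refl S : isomorphic S S.
Proof.
apply/isoP; exists (1%:M, sg 0); first by rewrite valid_mk ?unitmx1.
by rewrite actE (eq_imset _ sl_id) imset_id.
Qed.

Lemma iso_trans S T (U : {set vec F}) : isomorphic S T -> isomorphic T U -> isomorphic S U.
Proof.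
move=> /isoP[p vp <-] /isoP[q vq <-]; have [r vr h] := sl_comp vp vq.
by apply/isoP; exists r; rewrite ?(act_comp _ h).
Qed.

Lemma iso_sym S T : isomorphic S T -> isomorphic T S.
Proof.
move=> /isoP[p vp <-]; have [r [vr h _]] := sl_inv vp; apply/isoP; exists r => //.
by rewrite actE -imset_comp (eq_imset _ h) imset_id.
Qed.

Lemma mem_pt v w : reflect (exists2 c : F, c != 0 & w = c *: v) (w \in pt_of v).
Proof.
by apply: (iffP imsetP) => -[c]; [rewrite inE => c0|move=> c0] => ->; exists c; rewrite ?inE.
Qed.

Lemma slZ i (M : 'M[F]_3) (c : F) v : sl (M, sg i) (c *: v) = (c ^+ (2 ^ i)) *: sl (M, sg i) v.
Proof.
rewrite !sl_sg scalemxAl; congr (_ *m _).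
by apply/matrixP => a b; rewrite !mxE exprMn.
Qed.

Lemma act_pt p v : valid p -> act p (pt_of v) = pt_of (sl p v).
Proof.
case/valid_sg => i _ ->; apply/setP => w; apply/imsetP/mem_pt.
  case=> _ /mem_pt[c c0 ->] ->; exists (c ^+ (2 ^ i)); last by rewrite -/(sl _ _) slZ.
  by rewrite expf_eq0 negb_and c0 orbT.
case=> c c0 ->; exists (c ^+ (2 ^ (7 * i.+1 - i)) *: v).
  (* This exponent inverts the i-th Frobenius power, and the subtraction is not truncated for any
     i. *)
  by apply/mem_pt; exists (c ^+ (2 ^ (7 * i.+1 - i))); rewrite // expf_eq0 negb_and c0 orbT.
rewrite -/(sl _ _) slZ -exprM -expnD subnK; last by lia.
by rewrite -[(7 * _)%N]addn0 expr_frob7 expr1.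
Qed.

Lemma pointP (P : {set vec F}) : reflect (exists2 v, v != 0 & P = pt_of v) (is_point P).
Proof.
by apply: (iffP existsP) => -[v]; [case/andP => ? /eqP|move=> ? ?]; exists v => //; apply/andP; split=> //; apply/eqP.
Qed.

Lemma pgl_pt p v : valid p -> v != 0 -> pgl_of p (pt_of v) = pt_of (sl p v).
Proof.
move=> vp v0; rewrite ffunE ifT ?act_pt //; apply/pointP; by exists v.
Qed.

Lemma pgl_comp p q r (P : {set vec F}) : valid p -> valid q -> valid r ->
  sl r =1 sl q \o sl p -> pgl_of r P = pgl_of q (pgl_of p P).
Proof.
move=> vp vq vr h; case: (boolP (is_point P)) => [/pointP[v v0 ->]|nP].
  by rewrite !pgl_pt ?sl_eq0 // h.
by rewrite !ffunE !(negPf nP).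
Qed.

Lemma pgl_ext p q : valid p -> valid q ->
  (forall v, exists2 c : F, c != 0 & sl p v = c *: sl q v) -> pgl_of p = pgl_of q.
Proof.
move=> vp vq h; apply/ffunP => P; case: (boolP (is_point P)) => [/pointP[v v0 ->]|nP].
  rewrite !pgl_pt //; have [c c0 ->] := h v; apply/setP => w; apply/mem_pt/mem_pt.
    by case=> d d0 ->; exists (d * c); rewrite ?mulf_neq0 // scalerA.
  by case=> d d0 ->; exists (d / c); rewrite ?mulf_neq0 ?invr_eq0 // scalerA mulfVK.
by rewrite !ffunE !(negPf nP).
Qed.

Lemma pgl_can p r (P : {set vec F}) : valid p -> valid r -> cancel (sl p) (sl r) ->
  pgl_of r (pgl_of p P) = P.
Proof.
move=> vp vr h; case: (boolP (is_point P)) => [/pointP[v v0 ->]|nP].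
  by rewrite !pgl_pt ?sl_eq0 // h.
by rewrite !ffunE !(negPf nP).
Qed.

(** Conjugation by the collineation taking S to T is injective and carries one group into the
    other. *)
Lemma leq_card_aut S T : isomorphic S T -> (#|aut_group S| <= #|aut_group T|)%N.
Proof.
move=> /isoP[g vg <-]; have [h [vh gh hg]] := sl_inv vg.
pose conj (f : {ffun {set vec F} -> {set vec F}}) := [ffun P => pgl_of g (f (pgl_of h P))].
have conjE f P : conj f P = pgl_of g (f (pgl_of h P)) by rewrite [LHS]ffunE.
have conj_inj : injective conj.
  move=> f f' /ffunP e; apply/ffunP => P; have := e (pgl_of g P).
  by rewrite !conjE !pgl_can // => /(congr1 (pgl_of h)); rewrite !pgl_can.
rewrite -(card_imset _ conj_inj); apply/subset_leq_card/subsetP => _ /imsetP[_ /imsetP[p] + -> ->].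
rewrite inE => /andP[vp /eqP pS].
have [q vq eq] := sl_comp vh vp; have [r vr er] := sl_comp vq vg.
apply/imsetP; exists r.
  rewrite inE vr (act_comp _ er) (act_comp _ eq) /=.
  have -> : act h (act g S) = S by rewrite !actE -imset_comp (eq_imset _ gh) imset_id.
  by rewrite pS eqxx.
by apply/ffunP => P; rewrite conjE (pgl_comp _ vq vg vr er) (pgl_comp _ vh vp vq eq).
Qed.

Lemma card_aut_iso S T : isomorphic S T -> #|aut_group S| = #|aut_group T|.
Proof. by move=> h; apply/eqP; rewrite eqn_leq !leq_card_aut // iso_sym. Qed.

(** * Rigidity of the conics of an arc *)

Definition vc a b c : vec F := \row_j (if j == i0 then a else if j == i1 then b else c).

Lemma vcE a b c : (vc a b c 0 i0 = a) * (vc a b c 0 i1 = b) * (vc a b c 0 i2 = c).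
Proof. by rewrite !mxE. Qed.

Lemma ord3P (j : 'I_3) : [\/ j = i0, j = i1 | j = i2].
Proof.
by case: j => -[|[|[|//]]] lt; [constructor 1 | constructor 2 | constructor 3]; apply: val_inj.
Qed.

Lemma vec_eq v w : v 0 i0 = w 0 i0 -> v 0 i1 = w 0 i1 -> v 0 i2 = w 0 i2 -> v = w.
Proof.
by move=> h0 h1 h2; apply/matrixP => i j; rewrite ord1; case: (ord3P j) => ->.
Qed.

Lemma vec_eq0 v : (v == 0) = [&& v 0 i0 == 0, v 0 i1 == 0 & v 0 i2 == 0].
Proof.
apply/eqP/and3P => [->|[/eqP h0 /eqP h1 /eqP h2]]; first by rewrite !mxE eqxx.
by apply: vec_eq; rewrite mxE.
Qed.

Definition qf (c : triple F) x y z :=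
  alpha c * x ^+ 2 + x * y + beta c * y ^+ 2 + lam c * z ^+ 2.

Lemma mem_conic (c : triple F) v :
  (v \in conic c) = (v != 0) && (qf c (v 0 i0) (v 0 i1) (v 0 i2) == 0).
Proof. by rewrite inE. Qed.

Lemma mem_nuc v :
  (v \in pt_of (nucleus F)) = [&& v 0 i0 == 0, v 0 i1 == 0 & v 0 i2 != 0].
Proof.
have nE : (nucleus F 0 i0 = 0) * (nucleus F 0 i1 = 0) * (nucleus F 0 i2 = 1) by rewrite !mxE.
apply/mem_pt/and3P => [[c c0 ->]|[/eqP h0 /eqP h1 h2]].
  by rewrite !mxE !eqxx mulr0 mulr1 eqxx.
by exists (v 0 i2) => //; apply: vec_eq; rewrite mxE nE ?mulr0 ?mulr1.
Qed.

Lemma mem_arc C v :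
  (v \in mathon_arc C) = [exists c in C, v \in conic c] || (v \in pt_of (nucleus F)).
Proof.
rewrite inE; congr (_ || _); apply/bigcupP/existsP => -[c].
  by move=> Cc vc; exists c; rewrite Cc.
by case/andP => Cc vc; exists c.
Qed.

Lemma leq_card_bigcup (I T : finType) (P : {set I}) (f : I -> {set T}) :
  (#|\bigcup_(i in P) f i| <= \sum_(i in P) #|f i|)%N.
Proof.
elim/big_rec2: _ => [|i m U _ h]; first by rewrite cards0.
by apply: leq_trans (leq_card_setU _ _) _; rewrite leq_add2l.
Qed.

(** The third coordinate of the point (1, x, z) of the conic, for nonzero [lam c]. *)
Definition conic_z (c : triple F) x := ((alpha c + x + beta c * x ^+ 2) / lam c) ^+ 64.

(** The 128 points (1, t, z) of c are mapped into the arc of D, at most one of them to the nucleus.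
    With at most four on each of at most seven conics there would be only 7 * 4 + 1 = 29. *)
Lemma pigeon_conic C D (c : triple F) p : valid p -> c \in C -> lam c != 0 -> (#|D| <= 7)%N ->
  act p (mathon_arc C) = mathon_arc D ->
  let w t := sl p (vc 1 t (conic_z c t)) in
  exists2 d, d \in D & (4 < #|[set t | w t \in conic d]|)%N.
Proof.
move=> vp Cc l0 cD e w; pose z := conic_z c.
have zE t : lam c * z t ^+ 2 = alpha c + t + beta c * t ^+ 2.
  by rewrite sqrtK mulrC mulfVK.
have wD t : w t \in mathon_arc D.
  rewrite -e mem_act // mem_arc; apply/orP; left; apply/existsP; exists c.
  by rewrite Cc mem_conic /qf vec_eq0 !vcE oner_eq0 /= zE expr1n mulr1 mul1r addxx.
case: (boolP [exists d in D, (4 < #|[set t | w t \in conic d]|)%N]) => [/existsP[d /andP[]]|].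
  by exists d.
rewrite negb_exists => /forallP small.
have n0 : (#|[set t | w t \in pt_of (nucleus F)]| <= 1)%N.
  apply/card_le1_eqP => t t'; rewrite !inE => /mem_pt[a a0 ht] /mem_pt[b b0 ht'].
  have [i hi ep] := valid_sg vp.
  have : w t' = sl p (((b / a) ^+ (2 ^ (7 - i))) *: vc 1 t (z t)).
    rewrite ep slZ -ep -exprM -expnD subnK 1?ltnW // [_ ^+ (2 ^ 7)]expr128.
    by rewrite -/(w t) ht ht' scalerA mulfVK.
  move/(sl_inj vp) => h; have := congr1 (fun v : vec F => v 0 i0) h.
  have := congr1 (fun v : vec F => v 0 i1) h; rewrite !mxE /= mulr1 => h1 h0.
  by rewrite -h0 mul1r in h1.
have : (128 <= 29)%N; last by [].
rewrite -[128%N]/(2 ^ 7)%N -hF -cardsT.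
have -> : [set: F] = (\bigcup_(d in D) [set t | w t \in conic d])
                      :|: [set t | w t \in pt_of (nucleus F)].
  apply/setP => t; rewrite in_setT in_setU [t \in [set _ | _]]in_set; apply/esym.
  have := wD t; rewrite mem_arc.
  case/orP => [/existsP[d /andP[Dd ht]]|->]; last by rewrite orbT.
  by apply/orP; left; apply/bigcupP; exists d; rewrite // in_set.
apply: leq_trans (leq_card_setU _ _) _; rewrite -[29%N]/(28 + 1)%N leq_add //.
apply: leq_trans (leq_card_bigcup _ _) _.
apply: (@leq_trans (\sum_(d in D) 4)%N).
  by apply: leq_sum => d Dd; have := small d; rewrite Dd -leqNgt.
by rewrite sum_nat_const -[28%N]/(7 * 4)%N leq_mul2r cD orbT.
Qed.

(* sigma(c) vanishes on the pull-back of d at more than four points, so the two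
   quadratic forms are proportional (with ratio h); the absence of xz and yz terms
   then forces the nucleus to be fixed. *)
Lemma rigid (M : 'M[F]_3) i C D (c : triple F) :
  valid (M, sg i) -> c \in C -> lam c != 0 -> (#|D| <= 7)%N ->
  {in D, forall d, lam d != 0} ->
  act (M, sg i) (mathon_arc C) = mathon_arc D ->
  let h := M i0 i0 * M i1 i1 + M i1 i0 * M i0 i1 in
  [/\ M i2 i0 = 0, M i2 i1 = 0, h != 0 &
   exists2 d, d \in D &
   [/\ lam d * M i2 i2 ^+ 2 = h * lam c ^+ (2 ^ i),
       qf d (M i0 i0) (M i0 i1) (M i0 i2) = h * alpha c ^+ (2 ^ i) &
       qf d (M i1 i0) (M i1 i1) (M i1 i2) = h * beta c ^+ (2 ^ i)]].
Proof.
move=> vp Cc l0 cD lD e h.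
have [d Dd] := pigeon_conic vp Cc l0 cD e.
set p := (M, sg i) in vp e *; set T := [set t | _] => cT.
pose A := alpha c ^+ (2 ^ i); pose B := beta c ^+ (2 ^ i); pose L := lam c ^+ (2 ^ i).
have L0 : L != 0 by rewrite expf_eq0 negb_and l0 orbT.
pose a := qf d (M i0 i0) (M i0 i1) (M i0 i2).
pose b := qf d (M i1 i0) (M i1 i1) (M i1 i2).
pose k := qf d (M i2 i0) (M i2 i1) (M i2 i2).
pose f := M i1 i0 * M i2 i1 + M i2 i0 * M i1 i1.
pose g := M i0 i0 * M i2 i1 + M i2 i0 * M i0 i1.
have expand x y z : qf d (x * M i0 i0 + y * M i1 i0 + z * M i2 i0)
    (x * M i0 i1 + y * M i1 i1 + z * M i2 i1) (x * M i0 i2 + y * M i1 i2 + z * M i2 i2) =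
    a * x ^+ 2 + b * y ^+ 2 + k * z ^+ 2 + h * x * y + z * (f * y + g * x).
  by rewrite /a /b /k /f /g /h /qf; ring2.
(* On the points of c the pulled-back equation is solved for its term linear in z; squaring and the
   equation of c eliminate z. What remains is a quartic in t^(2^i) with these coefficients. *)
have [|_ /imsetP[t Tt ->]|h0 h1 h2 h3 h4] := @quartic0 (frob i T)
  ((L * a + k * A) ^+ 2 + L * A * g ^+ 2) (L * g ^+ 2)
  ((L * h + k) ^+ 2 + L * (A * f ^+ 2 + B * g ^+ 2)) (L * f ^+ 2)
  ((L * b + k * B) ^+ 2 + L * B * f ^+ 2).
- by rewrite card_imset //; exact: expr_frob_inj.
- move: Tt; rewrite inE mem_conic => /andP[_]; rewrite !slE /= !ffunE !vcE.
  rewrite expr1n; set z := conic_z c t; set s := t ^+ (2 ^ i); set zz := z ^+ (2 ^ i).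
  have hz : L * zz ^+ 2 = A + s + B * s ^+ 2.
    rewrite /zz -exprM mulnC exprM sqrtK exprMn exprVn mulrC mulfVK //.
    by rewrite !frobD exprMn -exprM (mulnC 2) exprM.
  rewrite expand => /eqP; rewrite expr1n !mulr1 => hq.
  have {}hq : a + b * s ^+ 2 + k * zz ^+ 2 + h * s = zz * (f * s + g).
    by apply: eq_add0; rewrite -[RHS]hq; ring.
  have : (L * (a + b * s ^+ 2 + h * s) + k * (A + s + B * s ^+ 2)) ^+ 2 =
         L * (A + s + B * s ^+ 2) * (f * s + g) ^+ 2.
    rewrite -hz (_ : _ + k * _ = L * (a + b * s ^+ 2 + k * zz ^+ 2 + h * s)); last by ring.
    by rewrite hq; ring.
  by move=> hq'; rewrite -[RHS](addxx (L * (A + s + B * s ^+ 2) * (f * s + g) ^+ 2)) -{1}hq'; ring2.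
have sq0 x : L * x ^+ 2 = 0 -> x = 0.
  by move/eqP; rewrite mulf_eq0 (negPf L0) sqrf_eq0 => /eqP.
have f0 := sq0 _ h3; have g0 := sq0 _ h1.
have sq0' x : x ^+ 2 = 0 -> x = 0 by move/eqP; rewrite sqrf_eq0 => /eqP.
move: h0 h2 h4; rewrite f0 g0 !expr0n !mulr0 !addr0 mulr0 addr0.
move=> /sq0'/eq_add0 ha /sq0'/eq_add0 hk /sq0'/eq_add0 hb.
have {}ha : a = h * A by apply: (mulfI L0); rewrite ha -hk; ring.
have {}hb : b = h * B by apply: (mulfI L0); rewrite hb -hk; ring.
(* If h = 0, the pulled-back form vanishes identically; but at the preimage of (0, 0, 1) its value
   is [lam d]. *)
have hn0 : h != 0.
  apply/eqP => h0; have [r [vr _ can]] := sl_inv vp.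
  have := lD _ Dd; apply/negP/negPn.
  pose v := sl r (vc 0 0 1).
  have := expand (v 0 i0 ^+ (2 ^ i)) (v 0 i1 ^+ (2 ^ i)) (v 0 i2 ^+ (2 ^ i)).
  rewrite ha hb -hk h0 f0 g0 !(mul0r, mulr0, addr0).
  have hv j : v 0 i0 ^+ (2 ^ i) * M i0 j + v 0 i1 ^+ (2 ^ i) * M i1 j + v 0 i2 ^+ (2 ^ i) * M i2 j
      = vc 0 0 1 0 j by have := slE p v j; rewrite can /= !ffunE.
  by rewrite !hv !vcE /qf !expr0n expr1n !(mul0r, mulr0, add0r, mulr1) => ->.
(* f = g = 0 is a linear system of determinant h in the first two entries of the last row. *)
have M0 : M i2 i0 = 0.
  apply: (mulIf hn0); rewrite mul0r.
  rewrite (_ : _ * h = M i0 i0 * f + M i1 i0 * g); first by rewrite f0 g0 !mulr0 addr0.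
  by rewrite /h /f /g; ring2.
have M1 : M i2 i1 = 0.
  apply: (mulIf hn0); rewrite mul0r.
  rewrite (_ : _ * h = M i0 i1 * f + M i1 i1 * g); first by rewrite f0 g0 !mulr0 addr0.
  by rewrite /h /f /g; ring2.
split=> //; exists d => //; split=> //.
by move: hk; rewrite /k /qf M0 M1 !expr0n !(mul0r, mulr0, add0r) mulrC => ->.
Qed.

(** * The polynomial shape of a Mathon set *)

(** The matrices that fix the nucleus, which is the shape forced by [rigid]. *)
Definition mx7 m00 m01 m02 m10 m11 m12 m22 : 'M[F]_3 := \matrix_(i, j)
  (if i == i0 then vc m00 m01 m02 0 j
   else if i == i1 then vc m10 m11 m12 0 j else vc 0 0 m22 0 j).

Lemma mx7_unit m00 m01 m02 m10 m11 m12 m22 :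
  m00 * m11 + m10 * m01 != 0 -> m22 != 0 ->
  mx7 m00 m01 m02 m10 m11 m12 m22 \in unitmx.
Proof.
move=> h0 g0; rewrite -row_free_unit; apply: inj_row_free => v hv.
have e j := congr1 (fun w : vec F => w 0 j) hv.
move: (e i0) (e i1) (e i2); rewrite !mxE !sum3 !mxE /= !mulr0 !addr0 => e0' e1' e2'.
have v0 : v 0 i0 = 0.
  apply: (mulIf h0); rewrite mul0r.
  transitivity (m11 * (v 0 i0 * m00 + v 0 i1 * m10) + m10 * (v 0 i0 * m01 + v 0 i1 * m11)).
    by ring2.
  by rewrite e0' e1' !mulr0 addr0.
have v1 : v 0 i1 = 0.
  apply: (mulIf h0); rewrite mul0r.
  transitivity (m01 * (v 0 i0 * m00 + v 0 i1 * m10) + m00 * (v 0 i0 * m01 + v 0 i1 * m11)).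
    by ring2.
  by rewrite e0' e1' !mulr0 addr0.
have v2 : v 0 i2 = 0.
  by apply: (mulIf g0); rewrite mul0r -e2' v0 v1 !mul0r !add0r.
by apply: vec_eq; rewrite ?v0 ?v1 ?v2 mxE.
Qed.

Lemma qf_frob i (c : triple F) x y z :
  qf c x y z ^+ (2 ^ i) = alpha c ^+ (2 ^ i) * (x ^+ (2 ^ i)) ^+ 2
    + x ^+ (2 ^ i) * y ^+ (2 ^ i) + beta c ^+ (2 ^ i) * (y ^+ (2 ^ i)) ^+ 2
    + lam c ^+ (2 ^ i) * (z ^+ (2 ^ i)) ^+ 2.
Proof. by rewrite /qf !(frobD i) !exprMn !expr2 ?exprMn. Qed.

(** The three equations say that the form of [g (phi l)], composed with the map, is h times the
    Frobenius image of the form of [f l]; so the conics correspond. This converse of [rigid]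
    constructs the explicit isomorphisms below. *)
Lemma transf i A V (f g : F -> triple F) (phi : F -> F) m00 m01 m02 m10 m11 m12 m22 :
  let h := m00 * m11 + m10 * m01 in h != 0 -> m22 != 0 ->
  phi @: A = V ->
  {in A, forall l, [/\ lam (g (phi l)) * m22 ^+ 2 = h * lam (f l) ^+ (2 ^ i),
    qf (g (phi l)) m00 m01 m02 = h * alpha (f l) ^+ (2 ^ i) &
    qf (g (phi l)) m10 m11 m12 = h * beta (f l) ^+ (2 ^ i)]} ->
  act (mx7 m00 m01 m02 m10 m11 m12 m22, sg i) (mathon_arc (f @: A)) =
    mathon_arc (g @: V).
Proof.
move=> h h0 g0 eV H; have M1 := mx7_unit m02 m12 h0 g0.
set p := (_, sg i); have vp : valid p by exact: valid_mk.
have E v : [/\ sl p v 0 i0 = v 0 i0 ^+ (2 ^ i) * m00 + v 0 i1 ^+ (2 ^ i) * m10,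
    sl p v 0 i1 = v 0 i0 ^+ (2 ^ i) * m01 + v 0 i1 ^+ (2 ^ i) * m11 &
    sl p v 0 i2 = v 0 i0 ^+ (2 ^ i) * m02 + v 0 i1 ^+ (2 ^ i) * m12 + v 0 i2 ^+ (2 ^ i) * m22].
  by rewrite !slE /= !ffunE !mxE /= !mulr0 !addr0.
have fr0 x : (x ^+ (2 ^ i) == 0) = (x == 0) by rewrite expf_eq0 expn_gt0.
suff main v : (sl p v \in mathon_arc (g @: V)) = (v \in mathon_arc (f @: A)).
  have [r [vr _ can]] := sl_inv vp.
  by apply/setP => w; rewrite -(can w) mem_act // main.
rewrite !mem_arc; congr (_ || _).
  have conicE l : l \in A -> (sl p v \in conic (g (phi l))) = (v \in conic (f l)).
    move=> Al; have [hl ha hb] := H l Al; rewrite !mem_conic sl_eq0 //; congr (_ && _).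
    have [-> -> ->] := E v.
    have -> : qf (g (phi l)) (v 0 i0 ^+ (2 ^ i) * m00 + v 0 i1 ^+ (2 ^ i) * m10)
        (v 0 i0 ^+ (2 ^ i) * m01 + v 0 i1 ^+ (2 ^ i) * m11)
        (v 0 i0 ^+ (2 ^ i) * m02 + v 0 i1 ^+ (2 ^ i) * m12 + v 0 i2 ^+ (2 ^ i) * m22) =
      h * qf (f l) (v 0 i0) (v 0 i1) (v 0 i2) ^+ (2 ^ i).
      rewrite qf_frob.
      set x := v 0 i0 ^+ _; set y := v 0 i1 ^+ _; set z := v 0 i2 ^+ _.
      rewrite !mulrDr !mulrA -ha -hb -hl /qf /h; ring2.
    by rewrite mulf_eq0 (negPf h0) fr0.
  apply/existsP/existsP => -[c /andP[/imsetP[l Al ->] hv]].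
    move: Al; rewrite -eV => /imsetP[k Ak ek]; exists (f k).
    by rewrite imset_f // -conicE // -ek.
  by exists (g (phi l)); rewrite conicE // hv imset_f // -eV imset_f.
rewrite !mem_nuc; have [-> -> ->] := E v.
set x := v 0 i0; set y := v 0 i1; set z := v 0 i2.
apply/and3P/and3P => -[/eqP hx /eqP hy hz]; last first.
  by rewrite hx hy !expr0n !expn_eq0 /= !mul0r !add0r mulf_neq0 // fr0.
have x0 : x = 0.
  apply/eqP; rewrite -fr0 -(mulIr_eq0 _ (mulIf h0)); apply/eqP.
  transitivity (m11 * (x ^+ (2 ^ i) * m00 + y ^+ (2 ^ i) * m10) +
                m10 * (x ^+ (2 ^ i) * m01 + y ^+ (2 ^ i) * m11)).
    by rewrite /h; ring2.
  by rewrite hx hy !mulr0 addr0.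
have y0 : y = 0.
  apply/eqP; rewrite -fr0 -(mulIr_eq0 _ (mulIf h0)); apply/eqP.
  transitivity (m01 * (x ^+ (2 ^ i) * m00 + y ^+ (2 ^ i) * m10) +
                m00 * (x ^+ (2 ^ i) * m01 + y ^+ (2 ^ i) * m11)).
    by rewrite /h; ring2.
  by rewrite hx hy !mulr0 addr0.
split; rewrite ?x0 ?y0 //; move: hz.
rewrite x0 y0 !expr0n !expn_eq0 /= !mul0r !add0r mulf_eq0 negb_or fr0.
by case/andP.
Qed.

(** Dividing a linearized polynomial of degree at most 4 by its variable leaves the exponents 0, 1
    and 3. *)
Definition gc a0 a1 a2 b0 b1 b2 l : triple F :=
  ((a0 + a1 * l + a2 * l ^+ 3, b0 + b1 * l + b2 * l ^+ 3), l).

Lemma mathonP C : mathon_set 7 C ->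
  [/\ {in C, forall c : triple F, tr (alpha c * beta c) = 1}, {in C, forall c : triple F, lam c != 0},
      {in C &, injective (@lam F)} &
      {in C &, forall c d : triple F, c != d -> oplus c d \in C}].
Proof.
case/andP => /forall_inP ok /forall_inP cl; split.
- by move=> c /ok /andP[/eqP].
- by move=> c /ok /andP[].
- move=> c d Cc Cd; case: (eqVneq c d) => [//|ne].
  by have /forall_inP/(_ d Cd) := cl c Cc; rewrite ne => /andP[/eqP].
by move=> c d Cc Cd ne; have /forall_inP/(_ d Cd) := cl c Cc; rewrite ne => /andP[].
Qed.

Definition lams C := 0 |: [set lam c | c in C].

Lemma subsp_lams C : mathon_set 7 C -> subsp (lams C).
Proof.
case/mathonP => _ l0 linj cl; apply/subspP; rewrite !inE eqxx; split=> // x y.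
rewrite !inE => /orP[/eqP->|Cx]; first by rewrite add0r.
case/orP => [/eqP->|Cy]; first by rewrite addr0 Cx orbT.
case/imsetP: Cx => c Cc ->; case/imsetP: Cy => d Cd ->.
case: (eqVneq c d) => [->|ne]; first by rewrite addxx eqxx.
by apply/orP; right; apply/imsetP; exists (oplus c d); rewrite ?cl.
Qed.

Lemma card_lams C : mathon_set 7 C -> #|lams C| = #|C|.+1.
Proof.
case/mathonP => _ l0 linj _; rewrite cardsU1 card_in_imset //.
by case: imsetP => [[c /l0 + ec]|//]; rewrite -ec eqxx.
Qed.

(** By the formula for [oplus], the product of lambda and the projection is additive on [lams C], so
    [linearized] applies; one then divides by lambda. *)
Lemma lams_linear C (proj : triple F -> F) : mathon_set 7 C -> #|C| = 7%N ->
  (forall c d : triple F, proj (oplus c d) = (proj c * lam c + proj d * lam d) / (lam c + lam d)) ->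
  exists c0 c1 c2, {in C, forall c : triple F, proj c = c0 + c1 * lam c + c2 * lam c ^+ 3}.
Proof.
move=> mC cC hproj; have [_ l0 linj cl] := mathonP mC.
(* A conic of C is determined by its lambda. No lambda is 0, so the default value makes f 0 = 0. *)
pose f x := if [pick c : triple F in C | lam c == x] is Some c then proj c * x else 0.
have fE (c : triple F) : c \in C -> f (lam c) = proj c * lam c.
  move=> Cc; rewrite /f; case: pickP => [d /andP[Cd /eqP e]|/(_ c)]; last by rewrite Cc eqxx.
  by rewrite (linj d c).
have f0 : f 0 = 0.
  rewrite /f; case: pickP => [d /andP[/l0 + /eqP e]|//].
  by rewrite e eqxx.
have [||c0 [c1 [c2 h]]] := @linearized (lams C) f (subsp_lams mC).
- by rewrite card_lams // cC.
- move=> x y; rewrite !inE => /orP[/eqP->|Cx]; first by rewrite f0 !add0r.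
  case/orP => [/eqP->|Cy]; first by rewrite f0 !addr0.
  case/imsetP: Cx => c Cc ->; case/imsetP: Cy => d Cd ->.
  case: (eqVneq c d) => [->|ne]; first by rewrite !addxx f0.
  have Ccd := cl _ _ Cc Cd ne.
  rewrite -[lam c + lam d]/(lam (oplus c d)) !fE // hproj mulfVK //; exact: (l0 _ Ccd).
exists c0, c1, c2 => c Cc; apply: (mulIf (l0 _ Cc)).
by rewrite -fE // h ?inE ?imset_f ?orbT // /lin; ring.
Qed.

Lemma mathon_param C : mathon_set 7 C -> #|C| = 7%N ->
  exists A a0 a1 a2 b0 b1 b2, [/\ subsp A, #|A| = 8%N,
    C = gc a0 a1 a2 b0 b1 b2 @: (A :\ 0) &
    {in A :\ 0, forall l, tr ((a0 + a1 * l + a2 * l ^+ 3) * (b0 + b1 * l + b2 * l ^+ 3)) = 1}].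
Proof.
move=> mC cC; have [t1 l0 _ _] := mathonP mC.
have [//|a0 [a1 [a2 ha]]] := lams_linear (proj := @alpha F) mC cC.
have [//|b0 [b1 [b2 hb]]] := lams_linear (proj := @beta F) mC cC.
exists (lams C), a0, a1, a2, b0, b1, b2; rewrite subsp_lams // card_lams // cC.
have eA : lams C :\ 0 = [set lam c | c in C].
  by rewrite setU1K //; apply/imsetP => -[c /l0 + ec]; rewrite -ec eqxx.
have cE (c : triple F) : c \in C -> gc a0 a1 a2 b0 b1 b2 (lam c) = c.
  by move=> Cc; rewrite /gc -ha // -hb //; case: c {Cc} => -[].
rewrite eA; split=> //; last by move=> _ /imsetP[c Cc ->]; rewrite -ha // -hb // t1.
by rewrite -imset_comp -[LHS]imset_id; apply: eq_in_imset => c /cE /= ->.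
Qed.

(** * Normal form *)

Lemma sum_odd A : subsp A -> #|A| = 8%N ->
  \sum_(x in A) x = 0 /\ \sum_(x in A) x ^+ 3 = 0.
Proof.
move=> sA cA; have [l [m [n [fr ->]]]] := basis sA cA.
by rewrite !sum_sp3 //; split; ring2.
Qed.

(* The sum over A of a polynomial function of GF(2)-degree at most 2 vanishes. *)
Lemma trace_const A a0 a1 a2 b0 b1 b2 : subsp A -> #|A| = 8%N ->
  {in A :\ 0, forall l, tr ((a0 + a1 * l + a2 * l ^+ 3) * (b0 + b1 * l + b2 * l ^+ 3)) = 1} ->
  tr (a0 * b0) = 1.
Proof.
move=> sA cA h; have [s1 s3] := sum_odd sA cA.
pose P x := (a0 + a1 * x + a2 * x ^+ 3) * (b0 + b1 * x + b2 * x ^+ 3).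
have A0 : 0 \in A by case/subspP: sA.
have sq (f : F -> F) : \sum_(x in A) f x ^+ 2 = (\sum_(x in A) f x) ^+ 2.
  by rewrite (frob_sum 1).
have sP : \sum_(x in A) P x = 0.
  (* Every positive exponent is 1 or 3 times a power of two, so the sums reduce to those of x and
     x^3; the constant term occurs eight times. *)
  rewrite (eq_bigr (fun x => a0 * b0 + ((a0 * b1 + a1 * b0) * x + (a0 * b2 + a2 * b0) * x ^+ 3
     + a1 * b1 * x ^+ 2 + (a1 * b2 + a2 * b1) * (x ^+ 2) ^+ 2 + a2 * b2 * (x ^+ 3) ^+ 2))).
    rewrite !big_split -!mulr_sumr !sq s1 s3 sumr_const cA !expr0n /= !mulr0 !addr0.
    by rewrite -mulr_natr e8 !mulr0.
  by move=> x _; rewrite /P; ring.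
(* The seven nonzero elements contribute trace 1 each, so the term at 0 must have trace 7 = 1. *)
have := congr1 tr sP; rewrite tr0 tr_sum (bigD1 0) //= {1}/P !expr0n /= !mulr0 !addr0.
rewrite (eq_bigr (fun=> 1)) => [|x /andP[Ax x0]]; last by apply: h; rewrite in_setD1 x0.
rewrite (eq_bigl [in A :\ 0]); last by move=> x; rewrite in_setD1 andbC.
have := cardsD1 0 A; rewrite cA A0 add1n => -[c7]; rewrite sumr_const -c7 => e.
by apply: eq_add0; rewrite -[RHS]e (_ : 1 *+ 7 = 7) //; ring2.
Qed.

(** The substitution y -> y + t x turns the coefficient a of a x^2 + x y + b y^2 into a + t + b t^2;
    the trace condition is invariant under it. *)
Lemma tr_swap_form a b t : tr ((a + t + b * t ^+ 2) * b) = tr (a * b).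
Proof.
rewrite (_ : _ * b = a * b + ((b * t) ^+ 2 + b * t)); last by ring.
by rewrite trD tr_add_sqr addr0.
Qed.

Lemma iso_transf A V (f g : F -> triple F) (phi : F -> F) m00 m01 m02 m10 m11 m12 m22 :
  m00 * m11 + m10 * m01 = 1 -> m22 != 0 -> phi @: A = V ->
  {in A, forall l, [/\ lam (g (phi l)) * m22 ^+ 2 = lam (f l),
    qf (g (phi l)) m00 m01 m02 = alpha (f l) & qf (g (phi l)) m10 m11 m12 = beta (f l)]} ->
  isomorphic (mathon_arc (f @: A)) (mathon_arc (g @: V)).
Proof.
move=> h1 g0 eV H; apply/isoP.
have h0 : m00 * m11 + m10 * m01 != 0 by rewrite h1 oner_neq0.
exists (mx7 m00 m01 m02 m10 m11 m12 m22, sg 0); first by rewrite valid_mk ?mx7_unit.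
by apply: transf eV _ => // l /H; rewrite h1 !mul1r !expr1.
Qed.

(** Scaling y by a square root of b0, and x inversely, makes the constant term of beta 1. Then y ->
    y + t x with t^2 + t = a0 b0 + 1 does the same for alpha; t exists because a0 b0 and 1 both have
    trace 1. *)
Lemma normalize_const A a0 a1 a2 b0 b1 b2 : subsp A -> #|A| = 8%N ->
  {in A :\ 0, forall l, tr ((a0 + a1 * l + a2 * l ^+ 3) * (b0 + b1 * l + b2 * l ^+ 3)) = 1} ->
  exists c1 c2 d1 d2,
    isomorphic (mathon_arc (gc a0 a1 a2 b0 b1 b2 @: (A :\ 0)))
               (mathon_arc (gc 1 c1 c2 1 d1 d2 @: (A :\ 0))) /\
    {in A :\ 0, forall l, tr ((1 + c1 * l + c2 * l ^+ 3) * (1 + d1 * l + d2 * l ^+ 3)) = 1}.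
Proof.
move=> sA cA h; have t1 := trace_const sA cA h.
have [t ht] : exists t, t ^+ 2 + t = a0 * b0 + 1 by apply: tr0_solve; rewrite trD t1 tr1 addxx.
have b00 : b0 != 0 by apply/eqP => b00; move/eqP: t1; rewrite b00 mulr0 tr0 eq_sym oner_eq0.
pose s := b0 ^+ 64; have hs : s ^+ 2 = b0 by exact: sqrtK.
have s0 : s != 0 by rewrite -sqrf_eq0 hs.
exists (a1 * b0 + b1 / b0 * t ^+ 2), (a2 * b0 + b2 / b0 * t ^+ 2), (b1 / b0), (b2 / b0).
set d1 := b1 / b0; set d2 := b2 / b0; set c1 := a1 * b0 + _; set c2 := a2 * b0 + _.
have eb l : b0 + b1 * l + b2 * l ^+ 3 = (1 + d1 * l + d2 * l ^+ 3) * b0.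
  by rewrite /d1 /d2; field.
have ea l : a0 + a1 * l + a2 * l ^+ 3 =
    ((1 + c1 * l + c2 * l ^+ 3) + t + (1 + d1 * l + d2 * l ^+ 3) * t ^+ 2) / b0.
  apply: (mulIf b00); rewrite mulfVK //.
  have e0 : a0 * b0 = t ^+ 2 + t + 1 by rewrite ht addxK.
  by rewrite !mulrDl e0 /c1 /c2; ring2.
clearbody c1 c2 d1 d2 s; split.
  apply: (@iso_transf _ _ _ _ id s^-1 (t / s) 0 0 s 0 1); rewrite ?oner_neq0 ?imset_id //.
    by rewrite mulVf // mul0r addr0.
  move=> l _; rewrite /qf /alpha /beta /lam /= eb ea -hs expr0n /= !(mulr0, addr0, add0r, mul0r).
  by split; [ring | field | ring].
move=> l /h; rewrite eb ea => e; rewrite -[RHS]e -[LHS](tr_swap_form _ _ t).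
by congr (tr _); field.
Qed.

Definition nf u l : triple F := ((1 + u * l + l ^+ 3, 1), l).

(** On A the quadratic form Tr(l^3) equals the linear form Tr(u l), so its polar form vanishes
    there. *)
Lemma isot_of_trace A u : subsp A -> #|A| = 8%N ->
  {in A, forall l, tr (l ^+ 3 + u * l) = 0} -> isot A.
Proof.
move=> sA cA h; have /subspP[_ AD] := sA; apply/isotP; split=> // x y Ax Ay.
have E z : z \in A -> tr (z ^+ 3) = tr (u * z).
  by move=> /h; rewrite trD => /eq_add0.
have := tr_cubeD x y; rewrite !E ?AD // mulrDr trD => /eqP.
by rewrite -{1}[_ + _]addr0 (inj_eq (addrI _)) => /eqP.
Qed.

Lemma scale_subsp k A : k != 0 -> subsp A -> subsp [set k * x | x in A].
Proof.
move=> k0 /subspP[A0 AD]; apply/subspP; split; first by apply/imsetP; exists 0; rewrite ?mulr0.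
by move=> _ _ /imsetP[x Ax ->] /imsetP[y Ay ->]; rewrite -mulrDr imset_f ?AD.
Qed.

(* Multiplication by an element p + q w of norm 1 of GF(q^2), with w^2 = w + 1,
   preserves x^2 + x y + y^2; for (p, q) proportional to (sqrt a2, sqrt b2) it maps
   a2 x^2 + b2 y^2 to a multiple of x^2. *)
Lemma normalize_cube A a1 a2 b1 b2 : subsp A -> #|A| = 8%N -> (a2 != 0) || (b2 != 0) ->
  {in A :\ 0, forall l, tr ((1 + a1 * l + a2 * l ^+ 3) * (1 + b1 * l + b2 * l ^+ 3)) = 1} ->
  exists V u, [/\ isot V, {in V, forall l, tr (l ^+ 3 + u * l) = 0} &
    isomorphic (mathon_arc (gc 1 a1 a2 1 b1 b2 @: (A :\ 0)))
               (mathon_arc (nf u @: (V :\ 0)))].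
Proof.
move=> sA cA ab0 h.
pose pa := a2 ^+ 64; have ha : pa ^+ 2 = a2 by exact: sqrtK.
pose qb := b2 ^+ 64; have hb : qb ^+ 2 = b2 by exact: sqrtK.
pose n := pa ^+ 2 + pa * qb + qb ^+ 2.
have n0 : n != 0.
  apply: contraTneq ab0 => nz; rewrite negb_or !negbK -ha -hb !sqrf_eq0.
  have [||-> ->] := @anisotropic 1 1 pa qb; rewrite ?eqxx // ?mul1r ?tr1 //.
pose sn := n ^+ 64; have hn : sn ^+ 2 = n by exact: sqrtK.
have sn0 : sn != 0 by rewrite -sqrf_eq0 hn.
(* 85 inverts 3 modulo 127, so k is the cube root of n. *)
pose k := n ^+ 85.
have hk : k ^+ 3 = n.
  by rewrite -exprM (_ : 85 * 3 = 128 + 127)%N // exprD expr128 -exprS expr128.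
have k0 : k != 0 by rewrite expf_eq0 negb_and n0 orbT.
(* The trace condition will read Tr(n l^3 + w l) = 0: inside the trace, roots move the terms in l^2
   and l^4 to l, and the term in l^6 to l^3. *)
pose w := a1 + b1 + (a1 * b1) ^+ 64 + (a1 * b2 + a2 * b1) ^+ 32.
pose p := pa / sn; pose q := qb / sn.
have pq1 : p ^+ 2 + p * q + q ^+ 2 = 1.
  apply: (mulIf n0); rewrite mul1r -[X in _ * X]hn -[RHS]/(pa ^+ 2 + pa * qb + qb ^+ 2) /p /q.
  by field.
have kp : k ^+ 3 * p ^+ 2 = a2 by rewrite hk expr_div_n hn ha mulrC mulfVK.
have kq : k ^+ 3 * q ^+ 2 = b2 by rewrite hk expr_div_n hn hb mulrC mulfVK.
pose V := [set k * x | x in A]; pose u := w / k.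
have tV : {in V, forall l, tr (l ^+ 3 + u * l) = 0}.
  move=> _ /imsetP[l Al ->].
  have -> : (k * l) ^+ 3 + u * (k * l) = n * l ^+ 3 + w * l by rewrite -hk /u; field.
  case: (eqVneq l 0) => [->|l0]; first by rewrite expr0n !mulr0 addr0 tr0.
  have /h e : l \in A :\ 0 by rewrite in_setD1 l0.
  pose c := 1 + ((a1 + b1) * l + (a2 + b2) * l ^+ 3 + a1 * b1 * l ^+ 2
    + (a1 * b2 + a2 * b1) * l ^+ 4 + (pa * qb * l ^+ 3) ^+ 2).
  have ec : (1 + a1 * l + a2 * l ^+ 3) * (1 + b1 * l + b2 * l ^+ 3) = c.
    by rewrite /c -ha -hb; ring.
  have t2 : tr (a1 * b1 * l ^+ 2) = tr ((a1 * b1) ^+ 64 * l).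
    by rewrite -[RHS]tr_sqr exprMn sqrtK.
  have t4 : tr ((a1 * b2 + a2 * b1) * l ^+ 4) = tr ((a1 * b2 + a2 * b1) ^+ 32 * l).
    move: (_ + _) => x; rewrite -[in LHS](expr128 x) -[RHS]tr_sqr -[RHS]tr_sqr.
    by congr (tr _); ring.
  rewrite ec /c trD tr1 !trD tr_sqr t2 t4 -!trD in e.
  have : tr (n * l ^+ 3 + w * l) + 1 = 1.
    by rewrite -[RHS]e addrC; congr (_ + tr _); rewrite /w /n ha hb; ring.
  by rewrite -[RHS]add0r => /addIr.
have sV : subsp V by exact: scale_subsp.
have cV : #|V| = 8%N by rewrite card_imset // => x y /(mulfI k0).
exists V, u; split=> //; first exact: isot_of_trace tV.
(* s1 and s2, the multiples of x and y added to z, restore the linear coefficients a1 and b1; g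
   rescales z so that l becomes k l. *)
pose s1 := (a1 / k + u * p ^+ 2) ^+ 64; have hs1 : s1 ^+ 2 = a1 / k + u * p ^+ 2 by exact: sqrtK.
pose s2 := (b1 / k + u * q ^+ 2) ^+ 64; have hs2 : s2 ^+ 2 = b1 / k + u * q ^+ 2 by exact: sqrtK.
pose g := k^-1 ^+ 64; have hg : g ^+ 2 = k^-1 by exact: sqrtK.
apply: (@iso_transf _ _ _ _ (fun x => k * x) p q s1 q (p + q) s2 g).
- by rewrite -[RHS]pq1; ring.
- by rewrite -sqrf_eq0 hg invr_eq0.
- apply/setP => x; rewrite in_setD1; apply/imsetP/andP => [[y]|[x0 /imsetP[y Ay ey]]].
    by rewrite in_setD1 => /andP[y0 Ay] ->; rewrite mulf_neq0 // imset_f.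
  by exists y; rewrite // in_setD1 Ay andbT; apply: contraNneq x0 => y0; rewrite ey y0 mulr0.
move=> l _; rewrite /qf /alpha /beta /lam /= hg hs1 hs2; split.
- by field.
- transitivity (p ^+ 2 + p * q + q ^+ 2 + a1 * l + k ^+ 3 * p ^+ 2 * l ^+ 3).
    by field2.
  by rewrite pq1 kp.
- transitivity (p ^+ 2 + p * q + q ^+ 2 + b1 * l + k ^+ 3 * q ^+ 2 * l ^+ 3).
    by field2.
  by rewrite pq1 kq.
Qed.

(** Without cubic terms, the new coordinate z + sqrt(a1) x + sqrt(b1) y absorbs the linear terms of
    alpha and beta. *)
Lemma normalize_denniston A a1 b1 :
  isomorphic (mathon_arc (gc 1 a1 0 1 b1 0 @: (A :\ 0)))
             (mathon_arc ((fun l => ((1, 1), l) : triple F) @: (A :\ 0))).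
Proof.
apply: (@iso_transf _ _ _ _ id 1 0 (a1 ^+ 64) 0 1 (b1 ^+ 64) 1); rewrite ?oner_neq0 ?imset_id //.
  by rewrite mulr1 mulr0 addr0.
by move=> l _; rewrite /qf /alpha /beta /lam /= !sqrtK; split; ring.
Qed.

(** * Counting points of an arc on a line *)

Lemma card_disjoint_bigcup (I T : finType) (P : {set I}) (f : I -> {set T}) :
  {in P &, forall i j, i != j -> [disjoint f i & f j]} ->
  #|\bigcup_(i in P) f i| = (\sum_(i in P) #|f i|)%N.
Proof.
move=> dis; rewrite -sum1_card big_mkcond /=.
under [RHS]eq_bigr => i _ do rewrite -sum1_card big_mkcond /=.
rewrite exchange_big /=; apply: eq_bigr => y _.
case: ifP => [/bigcupP[i Pi fy]|nf].
  rewrite (bigD1 i) //= fy big1 // => j /andP[Pj ji]; case: ifP => // fjy.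
  by have /pred0P/(_ y) := dis j i Pj Pi ji; rewrite /= fjy fy.
rewrite big1 // => i Pi; case: ifP => // fy.
by move/negP: nf; case; apply/bigcupP; exists i.
Qed.

Lemma card_nonzero : #|[set c : F | c != 0]| = 127%N.
Proof.
have := cardsC [set (0 : F)]; rewrite cards1 hF add1n => -[<-].
by apply: eq_card => x; rewrite !inE.
Qed.

Lemma card_pt v : v != 0 -> #|pt_of v| = 127%N.
Proof.
move=> v0; rewrite card_imset ?card_nonzero // => a b /eqP.
by rewrite -subr_eq0 -scalerBl scaler_eq0 (negPf v0) orbF subr_eq0 => /eqP.
Qed.

Lemma nuc_neq0 : nucleus F != 0.
Proof. by rewrite vec_eq0 !mxE /= oner_eq0 !andbF. Qed.

(** Disjointness is asked only inside Q: for a general Mathon set it will be verified on the line x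
    = 0 alone. *)
Lemma card_arc C (Q : pred (vec F)) :
  {in C &, forall c d : triple F, c != d ->
    forall v, Q v -> v \in conic c -> v \in conic d -> False} ->
  {in C, forall c : triple F, lam c != 0} ->
  #|[set v in mathon_arc C | Q v]| =
    (\sum_(c in C) #|[set v in conic c | Q v]| + #|[set v in pt_of (nucleus F) | Q v]|)%N.
Proof.
move=> dis l0; rewrite -card_disjoint_bigcup; last first.
  move=> c d Cc Cd ne; apply/pred0P => v /=; apply/negP => /andP[].
  by rewrite in_set => /andP[cv Qv]; rewrite in_set => /andP[dv _]; exact: (dis c d Cc Cd ne v).
rewrite -cardsUI [X in (_ + X)%N]eq_card0 ?addn0; last first.
  move=> v; rewrite inE; apply/negP => /andP[/bigcupP[c Cc]].
  rewrite [in X in X -> _]in_set => /andP[+ _]; rewrite [v \in [set _ in _ | _]]in_set => + /andP[+ _].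
  rewrite mem_conic mem_nuc /qf => /andP[_ h] /and3P[/eqP h0 /eqP h1 v2].
  by move: h; rewrite h0 h1 !expr0n !mulr0 !add0r mulf_eq0 sqrf_eq0 (negPf (l0 c Cc)) (negPf v2).
apply: eq_card => v; rewrite in_set in_setU [v \in [set _ in pt_of _ | _]]in_set.
case: (boolP (Q v)) => Qv; last first.
  rewrite !andbF orbF; apply/esym/negP => /bigcupP[c _].
  by rewrite in_set (negPf Qv) andbF.
rewrite !andbT mem_arc; congr (_ || _); apply/existsP/bigcupP => -[c].
  by case/andP => Cc cv; exists c => //; rewrite in_set cv.
by move=> Cc; rewrite in_set => /andP[cv _]; exists c; rewrite Cc.
Qed.

Lemma tr1_neq0 x : tr x = 1 -> x != 0.
Proof. by move=> h; apply/eqP => x0; move/eqP: h; rewrite x0 tr0 eq_sym oner_eq0. Qed.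

(** This reads the number of conics off the degree. The line x = 0 contains the nucleus and one
    point of each conic. If c and d shared that point, then beta c * lam d = beta d * lam c, and the
    trace belonging to [oplus c d] would be 1 + 1 = 0. *)
Lemma card_arc_axis C : mathon_set 7 C ->
  #|[set v in mathon_arc C | v 0 i0 == 0]| = (#|C|.+1 * 127)%N.
Proof.
case/mathonP => t1 l0 linj cl; rewrite card_arc //; last first.
  move=> c d Cc Cd ne v /eqP v0.
  rewrite !mem_conic /qf v0 !expr0n !mulr0 !mul0r !add0r => /andP[vn0 hc] /andP[_ hd].
  have ll : lam c + lam d != 0 by rewrite addx_eq0; apply: contra ne => /eqP/linj->.
  have y0 : v 0 i1 != 0.
    apply: contraNneq vn0 => y0; move: hc.
    by rewrite vec_eq0 v0 y0 expr0n mulr0 add0r mulf_eq0 sqrf_eq0 (negPf (l0 c Cc)) eqxx.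
  have bl : beta c * lam d = beta d * lam c.
    move: hc hd; rewrite !addx_eq0 => /eqP hc /eqP hd.
    apply: (mulIf (_ : v 0 i1 ^+ 2 != 0)); first by rewrite sqrf_eq0.
    by rewrite mulrAC hc [RHS]mulrAC hd; ring.
  have := t1 _ (cl _ _ Cc Cd ne).
  have -> : alpha (oplus c d) * beta (oplus c d) = alpha c * beta c + alpha d * beta d.
    rewrite /oplus /alpha /beta /= -!/(alpha _) -!/(beta _).
    apply: (mulIf (mulf_neq0 ll ll)); rewrite mulrACA !mulfVK //.
    apply: (mulIf (l0 _ Cc)).
    transitivity ((alpha c * lam c + alpha d * lam d) * (beta c * lam c ^+ 2 + beta d * lam c * lam d)).
      by ring.
    by rewrite -bl; transitivity (alpha c * beta c * lam c * (lam c + lam d) ^+ 2 +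
         alpha d * (beta c * lam d) * (lam c + lam d) ^+ 2); [ring2 | rewrite bl; ring].
  by rewrite trD !t1 // addxx => /eqP; rewrite eq_sym oner_eq0.
have -> : [set v in pt_of (nucleus F) | v 0 i0 == 0] = pt_of (nucleus F).
  by apply/setP => v; rewrite in_set mem_nuc; case: (_ == _); rewrite ?andbT ?andbF.
rewrite card_pt ?nuc_neq0 // mulSn addnC -sum_nat_const; congr (_ + _)%N; apply: eq_bigr => c Cc.
pose z := (beta c / lam c) ^+ 64; have hz : lam c * z ^+ 2 = beta c.
  by rewrite sqrtK mulrC mulfVK // l0.
clearbody z; rewrite -[RHS](@card_pt (vc 0 1 z)); last by rewrite vec_eq0 !mxE /= oner_eq0 andbF.
congr #|pred_of_set _|; apply/setP => v; rewrite in_set mem_conic /qf; apply/andP/mem_pt.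
  case=> /andP[v0 +] /eqP x0; rewrite x0 !expr0n !mulr0 !mul0r !add0r -hz addx_eq0 => /eqP h.
  have y0 : v 0 i1 != 0.
    apply: contraNneq v0 => y0; move/eqP: h.
    by rewrite vec_eq0 x0 y0 expr0n mulr0 eq_sym mulf_eq0 sqrf_eq0 (negPf (l0 c Cc)) eqxx.
  exists (v 0 i1) => //; apply: vec_eq; rewrite [RHS]mxE !vcE ?mulr0 ?mulr1 //.
  by apply/sqr_inj/(mulfI (l0 c Cc)); rewrite -h; ring.
case=> a a0 ->; rewrite vec_eq0 !mxE /= !mulr0 mulr1 (negPf a0) eqxx andbF; split=> //.
by rewrite -hz !expr0n !mulr0 !mul0r !add0r exprMn; apply/eqP; ring2.
Qed.

(** * Normal forms are maximal arcs *)

Definition nfset A u : {set triple F} := nf u @: (A :\ 0).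
Definition nfarc A u := mathon_arc (nfset A u).

Lemma mathon_set_image A (f : F -> F) : subsp A ->
  {in A :\ 0, forall l, tr (f l) = 1} -> additive_on A (fun l => f l * l) ->
  mathon_set 7 ((fun l => ((f l, 1), l) : triple F) @: (A :\ 0)).
Proof.
move=> sA f1 fD; have /subspP[_ AD] := sA; apply/andP; split.
  apply/forall_inP => _ /imsetP[l Al ->]; rewrite /conic_ok /alpha /beta /lam /= mulr1 f1 // eqxx.
  by move: Al; rewrite in_setD1 => /andP[].
apply/forall_inP => _ /imsetP[l Al ->]; apply/forall_inP => _ /imsetP[m Am ->].
apply/implyP => ne; have lm : l != m by apply: contra ne => /eqP->.
rewrite /lam /= lm; apply/imsetP; have lm0 : l + m != 0 by rewrite addx_eq0.
move: Al Am; rewrite !in_setD1 => /andP[_ Al] /andP[_ Am].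
exists (l + m); first by rewrite in_setD1 lm0 AD.
by rewrite /oplus /alpha /beta /lam /= !mul1r mulfV // -fD // mulfK.
Qed.

Section NormalArc.
Variables (A : {set F}) (u : F).
Hypotheses (iA : isot A) (tA : {in A, forall l, tr (l ^+ 3 + u * l) = 0}).

Lemma tr_nf l : l \in A -> tr (1 + u * l + l ^+ 3) = 1.
Proof. by move=> /tA h; rewrite -addrA [u * l + _]addrC trD h tr1 addr0. Qed.

Lemma card_isotD1 : #|A :\ 0| = 7%N.
Proof.
have /isotP[/subspP[A0 _] cA _] := iA.
by have := cardsD1 0 A; rewrite cA A0 add1n => -[<-].
Qed.

Lemma nf_inj (v : F) : injective (nf v).
Proof. by move=> x y []. Qed.

Lemma card_nfset : #|nfset A u| = 7%N.
Proof. by rewrite card_imset ?card_isotD1 //; exact: nf_inj. Qed.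

Lemma mathon_nf : mathon_set 7 (nfset A u).
Proof.
have /isotP[sA _ _] := iA; apply: (@mathon_set_image A (fun l => 1 + u * l + l ^+ 3)) => //.
  by move=> l /setD1P[_ Al]; exact: tr_nf.
by move=> x y _ _; ring2.
Qed.

Lemma nf_lam0 : {in nfset A u, forall c : triple F, lam c != 0}.
Proof. by case/mathonP: mathon_nf. Qed.

(** Adding the two equations and dividing by l + m expresses z^2 as a multiple of x^2. Substitution
    leaves a binary form with x^2-coefficient 1 + l^2 m + l m^2, of trace 1 by isotropy, hence
    anisotropic. *)
Lemma nf_disjoint : {in nfset A u &, forall c d : triple F, c != d ->
  forall v, v \in conic c -> v \in conic d -> False}.
Proof.
have /isotP[_ _ hA] := iA.
move=> _ _ /imsetP[l Al ->] /imsetP[m Am ->] ne v.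
have lm : l + m != 0 by rewrite addx_eq0; apply: contra ne => /eqP->.
move: Al Am; rewrite !in_setD1 => /andP[l0 Al] /andP[_ Am].
rewrite !mem_conic /qf /alpha /beta /lam /= !mul1r => /andP[v0 /eqP hl] /andP[_ /eqP hm].
move: (v 0 i0) (v 0 i1) (v 0 i2) hl hm (vec_eq0 v) => x y z hl hm.
have hz : z ^+ 2 = (u + l ^+ 2 + l * m + m ^+ 2) * x ^+ 2.
  apply/(mulfI lm)/eq_add0; rewrite -[RHS](addxx 0) -{1}hl -hm; ring2.
have [||x0 y0] := @anisotropic (1 + (l ^+ 2 * m + l * m ^+ 2)) 1 x y.
- by rewrite mulr1 trD tr1 -/(br l m) hA // addr0.
- by rewrite -[RHS]hl hz mul1r; ring2.
rewrite x0 y0 !eqxx /= => e; move: v0; rewrite e; case/negP.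
by move/eqP: hl; rewrite x0 y0 !expr0n !mulr0 !add0r mulf_eq0 sqrf_eq0 (negPf l0).
Qed.

Lemma card_arc_nf (Q : pred (vec F)) : #|[set v in nfarc A u | Q v]| =
    (\sum_(l in A :\ 0%R) #|[set v in conic (nf u l) | Q v]|
      + #|[set v in pt_of (nucleus F) | Q v]|)%N.
Proof.
rewrite card_arc; last exact: nf_lam0.
  by rewrite big_imset //=; move=> x y _ _; exact: nf_inj.
by move=> c d Cc Cd ne v _; exact: nf_disjoint.
Qed.

(** A line through the nucleus is tangent to every conic: it contains one point of each of the
    seven, and the nucleus. *)
Lemma line_nucleus (l : vec F) : l != 0 -> l 0 i2 = 0 ->
  #|[set v in nfarc A u | dotv v l == 0]| = (8 * 127)%N.
Proof.
move=> l0 l2; rewrite card_arc_nf.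
have dE v : (dotv v l == 0) = (v 0 i0 * l 0 i0 == v 0 i1 * l 0 i1).
  by rewrite /dotv sum3 l2 mulr0 addr0 addx_eq0.
have -> : [set v in pt_of (nucleus F) | dotv v l == 0] = pt_of (nucleus F).
  apply/setP => v; rewrite in_set; case: (boolP (v \in pt_of _)) => //.
  by rewrite mem_nuc dE => /and3P[/eqP-> /eqP-> _]; rewrite !mul0r eqxx.
rewrite card_pt ?nuc_neq0 // (_ : 8 * 127 = 7 * 127 + 127)%N //; congr (_ + _)%N.
rewrite -[X in _ = (X * _)%N]card_isotD1 -sum_nat_const; apply: eq_bigr => x /setD1P[x0 Ax].
set a := l 0 i0 in dE; set b := l 0 i1 in dE; set al := 1 + u * x + x ^+ 3.
pose z := ((al * b ^+ 2 + b * a + a ^+ 2) / x) ^+ 64.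
have hz : x * z ^+ 2 = al * b ^+ 2 + b * a + a ^+ 2 by rewrite sqrtK mulrC mulfVK.
clearbody z.
have w0 : vc b a z != 0.
  apply: contra l0; rewrite !vec_eq0 !mxE /= => /and3P[b0 a0 _].
  by rewrite a0 b0 l2 eqxx.
rewrite -[RHS](card_pt w0); congr #|pred_of_set _|; apply/setP => v.
rewrite in_set mem_conic /qf /alpha /beta /lam /= -/al mul1r dE.
apply/andP/mem_pt => [[/andP[v0 /eqP hv] /eqP e]|[c c0 ->]]; last first.
  rewrite scaler_eq0 negb_or c0 w0 !mxE /=; split; last by apply/eqP; ring.
  by apply/eqP; transitivity (c ^+ 2 * (al * b ^+ 2 + b * a + a ^+ 2 + x * z ^+ 2));
    [ring | rewrite hz addxx mulr0].
have [c hx hy] : exists2 c : F, v 0 i0 = c * b & v 0 i1 = c * a.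
  case: (eqVneq a 0) => [a0|a0].
    have b0 : b != 0 by apply: contraNneq l0 => b0; rewrite vec_eq0 -/a a0 -/b b0 l2 eqxx.
    exists (v 0 i0 / b); first by rewrite mulfVK.
    by move/eqP: e; rewrite a0 !mulr0 eq_sym mulf_eq0 (negPf b0) orbF => /eqP.
  by exists (v 0 i1 / a); [apply: (mulIf a0); rewrite e mulrAC mulfVK | rewrite mulfVK].
have hz' : v 0 i2 = c * z.
  apply/sqr_inj/(mulfI x0)/eq_add0; rewrite -[RHS]hv hx hy.
  by transitivity (c ^+ 2 * (x * z ^+ 2) + x * v 0 i2 ^+ 2); [ring | rewrite hz; ring].
exists c; last by apply: vec_eq; rewrite mxE !vcE.
by apply: contraNneq v0 => c0; rewrite vec_eq0 hx hy hz' c0 !mul0r eqxx.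
Qed.

(** With t^2 + t = a b, the form times a is (a x + t y)(a x + (t + 1) y). *)
Lemma split_form a b : tr (a * b) = 0 -> exists p q r s : F,
  p * s + q * r = 1 /\ forall x y, a * x ^+ 2 + x * y + b * y ^+ 2 = (p * x + q * y) * (r * x + s * y).
Proof.
move=> /tr0_solve[t ht]; case: (eqVneq a 0) => [->|a0].
  by exists 0, 1, 1, b; rewrite mul0r mul1r add0r; split=> // x y; ring.
exists 1, (t / a), a, (t + 1); split.
  by rewrite mulfVK //; ring2.
move=> x y; apply: (mulfI a0).
have -> : a * (a * x ^+ 2 + x * y + b * y ^+ 2) = a ^+ 2 * x ^+ 2 + a * x * y + (a * b) * y ^+ 2.
  by ring.
by rewrite -ht; field2.
Qed.

(** On the line z = a x + b y the conic becomes a binary form. The trace of the product of its outer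
    coefficients decides whether it is anisotropic or splits into two independent linear factors,
    each giving one point. *)
Lemma conic_secant (l : vec F) x : x \in A -> x != 0 -> l 0 i2 != 0 ->
  let a := l 0 i0 / l 0 i2 in let b := l 0 i1 / l 0 i2 in
  #|[set v in conic (nf u x) | dotv v l == 0]| =
  if tr ((1 + u * x + x ^+ 3 + x * a ^+ 2) * (1 + x * b ^+ 2)) == 1 then 0%N else (2 * 127)%N.
Proof.
move=> Ax x0 l2 a b; set al := 1 + u * x + x ^+ 3.
have dE v : (dotv v l == 0) = (v 0 i2 == a * v 0 i0 + b * v 0 i1).
  rewrite /dotv sum3 addx_eq0 eq_sym /a /b -(inj_eq (mulIf l2) (v 0 i2)); congr (_ == _).
  by field.
have alE : alpha (nf u x) = al by [].
clearbody a b al.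
have mE v : (v \in [set v in conic (nf u x) | dotv v l == 0]) =
  [&& v != 0, v 0 i2 == a * v 0 i0 + b * v 0 i1 &
   (al + x * a ^+ 2) * v 0 i0 ^+ 2 + v 0 i0 * v 0 i1 + (1 + x * b ^+ 2) * v 0 i1 ^+ 2 == 0].
  rewrite in_set mem_conic dE /qf alE /beta /lam /= -!andbA; congr (_ && _).
  by rewrite andbC; case: (v 0 i2 =P _) => [->|//]; congr (_ == 0); ring2.
case: eqP => [t1|].
  apply: eq_card0 => v; rewrite mE; apply/negP => /and3P[v0 /eqP ez /eqP q0].
  have [h0 h1] := anisotropic t1 q0.
  by case/negP: v0; rewrite vec_eq0 ez h0 h1 !mulr0 addr0 eqxx.
case: (tr_bit ((al + x * a ^+ 2) * (1 + x * b ^+ 2))) => // t0 _.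
have [p [q [r [s [d1 hf]]]]] := split_form t0.
have sol (p1 q1 : F) : (p1 != 0) || (q1 != 0) -> #|pt_of (vc q1 p1 (a * q1 + b * p1))| = 127%N.
  by move=> h; rewrite card_pt // vec_eq0 !mxE /= -[q1 == 0]negbK -[p1 == 0]negbK; move: h; do 2![case: (_ != 0)].
have onpt v (p1 q1 p2 q2 : F) : p1 * q2 + q1 * p2 = 1 -> p1 * v 0 i0 + q1 * v 0 i1 = 0 ->
    v != 0 -> v 0 i2 = a * v 0 i0 + b * v 0 i1 -> v \in pt_of (vc q1 p1 (a * q1 + b * p1)).
  move=> d e v0 ez; pose c := p2 * v 0 i0 + q2 * v 0 i1.
  have hx : v 0 i0 = c * q1.
    transitivity ((p1 * q2 + q1 * p2) * v 0 i0 + q2 * (p1 * v 0 i0 + q1 * v 0 i1)).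
      by rewrite d e mulr0 addr0 mul1r.
    by rewrite /c; ring2.
  have hy : v 0 i1 = c * p1.
    transitivity ((p1 * q2 + q1 * p2) * v 0 i1 + p2 * (p1 * v 0 i0 + q1 * v 0 i1)).
      by rewrite d e mulr0 addr0 mul1r.
    by rewrite /c; ring2.
  apply/mem_pt; exists c; last by apply: vec_eq; rewrite mxE !vcE // ez hx hy; ring.
  by apply: contraNneq v0 => c0; rewrite vec_eq0 ez hx hy c0 !mul0r !mulr0 addr0 eqxx.
have nz (p1 q1 p2 q2 : F) : p1 * q2 + q1 * p2 = 1 -> (p1 != 0) || (q1 != 0).
  move=> d; rewrite -negb_and; apply/negP => /andP[/eqP p0 /eqP q0].
  by move/eqP: d; rewrite p0 q0 !mul0r addr0 eq_sym oner_eq0.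
have d2 : r * q + s * p = 1 by rewrite -[RHS]d1; ring.
have -> : [set v in conic (nf u x) | dotv v l == 0] =
    pt_of (vc q p (a * q + b * p)) :|: pt_of (vc s r (a * s + b * r)).
  apply/setP => v; rewrite mE hf in_setU; apply/and3P/orP.
    case=> v0 /eqP ez; rewrite mulf_eq0 => /orP[]/eqP e; [left; exact: (onpt _ _ _ _ _ d1) | right].
    exact: (onpt _ _ _ _ _ d2).
  have back (p1 q1 p2 q2 : F) : p1 * q2 + q1 * p2 = 1 -> v \in pt_of (vc q1 p1 (a * q1 + b * p1)) ->
      [/\ v != 0, v 0 i2 == a * v 0 i0 + b * v 0 i1 & p1 * v 0 i0 + q1 * v 0 i1 = 0].
    move=> d /mem_pt[c c0 ->]; rewrite scaler_eq0 negb_or c0 !mxE /= ; split.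
    - by rewrite vec_eq0 !mxE /=; move: (nz _ _ _ _ d); do 2![case: (_ == 0)].
    - by apply/eqP; ring.
    - by ring2.
  by case=> [/(back _ _ _ _ d1)|/(back _ _ _ _ d2)] [-> -> ->]; rewrite ?mul0r ?mulr0 eqxx.
rewrite cardsU !sol ?(nz _ _ _ _ d1) ?(nz _ _ _ _ d2) // (_ : _ :&: _ = set0) ?cards0 //.
apply/setP => v; rewrite in_set0 in_setI; apply/negP => /andP[/mem_pt[c c0 ->] /mem_pt[c' c0' /matrixP e]].
have := e 0 i0; have := e 0 i1; rewrite !mxE /= => e1 e0.
have : c * c' = 0.
  transitivity ((c * p) * (c' * s) + (c * q) * (c' * r)).
    by rewrite -[LHS]mulr1 -d1; ring.
  by rewrite e1 e0; ring2.
by move/eqP; rewrite mulf_eq0 (negPf c0) (negPf c0').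
Qed.

(** The conic of x is secant to the line exactly when phi x = 1. As phi is additive with values in
    GF(2), this happens for 0 or 4 of the conics, giving 0 or 8 points. *)
Lemma line_other (l : vec F) : l 0 i2 != 0 ->
  let k := #|[set v in nfarc A u | dotv v l == 0]| in k = 0%N \/ k = (8 * 127)%N.
Proof.
move=> l2 /=; have /isotP[sA cA hA] := iA.
set a := l 0 i0 / l 0 i2; set b := l 0 i1 / l 0 i2.
pose phi x := tr (x * a ^+ 2 + x * b ^+ 2 + u * b ^+ 2 * x ^+ 2 + b ^+ 2 * x ^+ 4 + a ^+ 2 * b ^+ 2 * x ^+ 2).
have phiD : additive_on A phi by move=> x y _ _; rewrite /phi -trD; congr (tr _); ring2.
have phi0 : phi 0 = 0 by exact: additive_on0 phiD.
have pb x : (phi x != 0) = (phi x == 1) by exact: tr_neq0.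
have kE : #|[set v in nfarc A u | dotv v l == 0]| =
    (\sum_(x in A :\ 0%R) if phi x != 0%R then 2 * 127 else 0)%N.
  rewrite card_arc_nf [X in (_ + X)%N]eq_card0 ?addn0; last first.
    move=> v; rewrite in_set; apply/negP => /andP[]; rewrite mem_nuc.
    case/and3P => /eqP h0 /eqP h1 h2; rewrite /dotv sum3 h0 h1 !mul0r !add0r.
    by rewrite mulf_eq0 (negPf h2) (negPf l2).
  apply: eq_bigr => x /setD1P[x0 Ax]; rewrite conic_secant // -/a -/b.
  have -> : tr ((1 + u * x + x ^+ 3 + x * a ^+ 2) * (1 + x * b ^+ 2)) = 1 + phi x.
    rewrite -[in RHS](tr_nf Ax) /phi -trD; congr (tr _); ring.
  by rewrite -{2}[1]addr0 (inj_eq (addrI 1)) if_neg.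
rewrite kE -big_mkcondr /= sum_nat_const.
have -> : #|[pred x | (x \in A :\ 0) && (phi x != 0)]| = #|[set x in A | phi x == 1]|.
  apply: eq_card => x; rewrite in_set inE in_setD1 /= pb.
  by case: (eqVneq x 0) => [->|_] //=; rewrite phi0 eq_sym oner_eq0 andbF.
case: (boolP [exists x in A, phi x == 1]) => [/existsP[w /andP[Aw /eqP pw]]|none].
  right; have [||_ c4] := card_half sA phiD.
  - by move=> x _; exact: tr_bit.
  - by exists w.
  by rewrite cA in c4; rewrite (double_inj (c4 : _ = 4.*2)).
left; rewrite eq_card0 // => x; rewrite in_set; apply: contraNF none => h.
by apply/existsP; exists x.
Qed.

Lemma arcZ C v (c : F) : c != 0 -> v \in mathon_arc C -> c *: v \in mathon_arc C.
Proof.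
move=> c0; rewrite !mem_arc !mem_nuc => /orP[/existsP[d /andP[Cd dv]]|h]; apply/orP; [left|right].
  apply/existsP; exists d; rewrite Cd; move: dv; rewrite !mem_conic scaler_eq0 negb_or c0.
  case/andP => -> /eqP q0; rewrite !mxE /= /qf; apply/eqP.
  by rewrite -[RHS](mulr0 (c ^+ 2)) -q0 /qf; ring.
by rewrite !mxE !mulf_eq0 (negPf c0).
Qed.

Lemma nf_maxarc : is_maxarc 8 (nfarc A u).
Proof.
have nucA : nucleus F \in nfarc A u by rewrite mem_arc mem_nuc !mxE /= !eqxx oner_eq0 orbT.
apply/and4P; split.
- apply/andP; split.
    rewrite mem_arc mem_nuc !mxE eqxx /= orbF; apply/negP => /existsP[c /andP[_]].
    by rewrite mem_conic eqxx.
  apply/forall_inP => v Av; apply/forallP => c; apply/implyP => c0; exact: arcZ.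
- by apply/set0Pn; exists (nucleus F).
(* The point (1, 0, 0) is on no conic: every alpha has trace 1 and so is nonzero. *)
- apply/eqP => /setP/(_ (vc 1 0 0)); rewrite mem_arc in_set mem_nuc vec_eq0 !mxE /= oner_eq0 /= orbF.
  move/existsP => [_ /andP[/imsetP[l /setD1P[_ Al] ->]]]; rewrite mem_conic /qf !mxE /=.
  rewrite expr1n expr0n /= !mulr0 mulr1 !addr0 => /andP[_].
  by rewrite /alpha /= (negPf (tr1_neq0 (tr_nf Al))).
apply/forall_inP => l l0; rewrite hF -[(2 ^ 7 - 1)%N]/127%N /=.
by case: (eqVneq (l 0 i2) 0) => [/(line_nucleus l0)->|/line_other[->|->]].
Qed.

End NormalArc.

(** * Isomorphisms between normal forms *)

Lemma gt4_card (T : {set F}) (f : F -> F) : injective f -> (4 < #|T|)%N -> (4 < #|f @: T|)%N.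
Proof. by move=> inj; rewrite card_imset. Qed.

(* Comparing y^2-coefficients gives a cubic identity in l, which makes M upper
   unitriangular up to a scalar on the xy-plane. *)
Lemma nf_rigid (M : 'M[F]_3) i (T : {set F}) (f : F -> F) V (v : F) :
  valid (M, sg i) -> (4 < #|T|)%N -> 0 \notin T -> isot V ->
  act (M, sg i) (mathon_arc ((fun l => ((f l, 1), l) : triple F) @: T)) = nfarc V v ->
  exists r t m k : F, [/\ r != 0, k != 0, r ^+ 2 = k * M i2 i2 ^+ 2,
    M = mx7 r (r * t) (r * m) 0 r 0 (M i2 i2) &
    {in T, forall l, k * l ^+ (2 ^ i) \in V :\ 0 /\
      f l ^+ (2 ^ i) = 1 + v * (k * l ^+ (2 ^ i)) + (k * l ^+ (2 ^ i)) ^+ 3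
                       + t ^+ 2 + t + k * l ^+ (2 ^ i) * m ^+ 2}].
Proof.
move=> vp cT nT iV e.
have cD : (#|nfset V v| <= 7)%N by rewrite card_nfset.
have lD : {in nfset V v, forall d : triple F, lam d != 0}.
  by move=> _ /imsetP[l /setD1P[l0 _] ->].
pose src l : triple F := ((f l, 1), l).
have R l : l \in T -> _ := fun Tl => rigid vp (imset_f src Tl)
  (contraNneq (fun h : l = 0 => etrans (congr1 (fun x => x \in T) (esym h)) Tl) nT) cD lD e.
have [l0 Tl0] : exists l, l \in T.
  by apply/set0Pn; rewrite -cards_eq0; case: #|T| cT.
move: (R l0 Tl0); set h := _ + _ => /= -[M20 M21 h0 _].
have l0N l : l \in T -> l != 0 by move=> Tl; apply: contraNneq nT => <-.
have [g0 hg] : M i2 i2 != 0 /\ {in T, forall l, exists2 l', l' \in V :\ 0 &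
   [/\ l' * M i2 i2 ^+ 2 = h * l ^+ (2 ^ i),
       qf (nf v l') (M i0 i0) (M i0 i1) (M i0 i2) = h * f l ^+ (2 ^ i) &
       qf (nf v l') (M i1 i0) (M i1 i1) (M i1 i2) = h]}.
  have H l : l \in T -> exists2 l', l' \in V :\ 0 &
   [/\ l' * M i2 i2 ^+ 2 = h * l ^+ (2 ^ i),
       qf (nf v l') (M i0 i0) (M i0 i1) (M i0 i2) = h * f l ^+ (2 ^ i) &
       qf (nf v l') (M i1 i0) (M i1 i1) (M i1 i2) = h].
    case/R => _ _ _ [_ /imsetP[l' Vl' ->]]; rewrite /alpha /beta /lam /= expr1n mulr1 => H.
    by exists l'.
  split=> //; have [l' _ [hl _ _]] := H l0 Tl0; apply: contraTneq h0 => g0; rewrite negbK.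
  move/eqP: hl; rewrite g0 expr0n mulr0 eq_sym mulf_eq0 expf_eq0 (negPf (l0N _ Tl0)) andbF orbF.
  by [].
(* Up to the Frobenius power, lambda is multiplied by the same factor k on all conics. *)
pose k := h / M i2 i2 ^+ 2.
have g20 : M i2 i2 ^+ 2 != 0 by rewrite sqrf_eq0.
have k0 : k != 0 by rewrite mulf_neq0 ?invr_eq0.
have hk l : l \in T -> [/\ k * l ^+ (2 ^ i) \in V :\ 0,
       qf (nf v (k * l ^+ (2 ^ i))) (M i0 i0) (M i0 i1) (M i0 i2) = h * f l ^+ (2 ^ i) &
       qf (nf v (k * l ^+ (2 ^ i))) (M i1 i0) (M i1 i1) (M i1 i2) = h].
  case/hg => l' Vl' [hl' hx hy].
  suff -> : k * l ^+ (2 ^ i) = l' by [].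
  by apply: (mulIf g20); rewrite hl' mulrAC mulfVK.
have [|_ /imsetP[l Tl ->]|c0 c1 _ c3 _] := @quartic0 [set k * l ^+ (2 ^ i) | l in T]
   (M i1 i0 ^+ 2 + M i1 i0 * M i1 i1 + M i1 i1 ^+ 2 + h)
   (M i1 i0 ^+ 2 * v + M i1 i2 ^+ 2) 0 (M i1 i0 ^+ 2) 0.
- by apply: gt4_card cT => x y /(mulfI k0); exact: expr_frob_inj.
- have [_ _] := hk l Tl; move: (k * _) => x.
  by rewrite /qf /alpha /beta /lam /= => hq; rewrite -[RHS](addxx h) -{2}hq; ring2.
have sq0 x : x ^+ 2 = 0 -> x = 0 by move/eqP; rewrite sqrf_eq0 => /eqP.
have M10 := sq0 _ c3; have M12 : M i1 i2 = 0 by apply: sq0; rewrite -c1 M10 expr0n mul0r add0r.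
have hE : h = M i1 i1 ^+ 2.
  by apply/esym/eq_add0; rewrite -[RHS]c0 M10 expr0n mul0r !add0r.
have r0 : M i1 i1 != 0 by rewrite -sqrf_eq0 -hE.
have M00 : M i0 i0 = M i1 i1.
  by apply: (mulIf r0); rewrite -expr2 -hE /h M10 mul0r addr0.
exists (M i1 i1), (M i0 i1 / M i1 i1), (M i0 i2 / M i1 i1), k; split=> //.
- by rewrite -hE mulfVK.
- apply/matrixP => a b; case: (ord3P a) => ->; case: (ord3P b) => ->; rewrite !mxE //=.
  + by rewrite mulrC mulfVK.
  + by rewrite mulrC mulfVK.
move=> l Tl; have [Vl hx _] := hk l Tl; split=> //; move: hx; move: (k * _) => x.
rewrite /qf /alpha /beta /lam /= M00 hE => hx.
apply: (mulfI (_ : M i1 i1 ^+ 2 != 0)); first by rewrite sqrf_eq0.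
by rewrite -hx; field.
Qed.

Definition nf_mx t m := mx7 1 t m 0 1 0 1.

Lemma nf_mx_unit t m : nf_mx t m \in unitmx.
Proof. by rewrite mx7_unit ?oner_neq0 // mulr1 mul0r addr0 oner_neq0. Qed.

(** The x^2-coefficients give two cubics in k l^(2^i) that agree at seven points. Constant terms
    yield t^2 + t = 0, cubic terms k^3 = 1 and hence k = 1, and linear terms determine m. *)
Lemma nf_iso_shape (M : 'M[F]_3) i A u V (v : F) : valid (M, sg i) -> isot A -> isot V ->
  act (M, sg i) (nfarc A u) = nfarc V v ->
  V = frob i A /\ exists r t : F, [/\ r != 0, t = 0 \/ t = 1 &
    M = r *: nf_mx t ((u ^+ (2 ^ i) + v) ^+ 64)].
Proof.
move=> vp iA iV e; have cA1 := card_isotD1 iA.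
have [||r [t [m [k [r0 k0 hr eM H]]]]] := nf_rigid (f := fun l => 1 + u * l + l ^+ 3) vp _ _ iV e.
- by rewrite cA1.
- by rewrite setD11.
pose k' := k^-1.
have [|_ /imsetP[l Tl ->]|c0 c1 _ c3 _] := @quartic0 [set k * l ^+ (2 ^ i) | l in A :\ 0]
   (t ^+ 2 + t) (v + m ^+ 2 + u ^+ (2 ^ i) * k') 0 (1 + k' ^+ 3) 0.
- by apply: gt4_card => [x y /(mulfI k0)|]; [exact: expr_frob_inj | rewrite cA1].
- have [_] := H l Tl; rewrite !(frobD i) expr1n exprMn exprAC.
  set x := k * _; have -> : l ^+ (2 ^ i) = k' * x by rewrite mulrA mulVf // mul1r.
  clearbody x k' => hx.
  by rewrite -[RHS](addxx (1 + u ^+ (2 ^ i) * (k' * x) + (k' * x) ^+ 3)) [X in _ = _ + X]hx; ring2.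
have k1 : k = 1.
  have /cube_inj1 : k' ^+ 3 = 1 by apply/esym/eq_add0.
  by move=> k1; rewrite -[k]invrK -/k' k1 invr1.
have er : M i2 i2 = r by apply/sqr_inj; rewrite hr k1 mul1r.
have tb : t = 0 \/ t = 1 by apply/bit_of_sqr/eq_add0.
have em : m = (u ^+ (2 ^ i) + v) ^+ 64.
  apply: sqr_inj; rewrite sqrtK; apply: eq_add0.
  by rewrite -[RHS]c1 /k' k1 invr1 mulr1; ring.
split.
  have /isotP[/subspP[V0 _] cV _] := iV; have /isotP[/subspP[A0 _] cA _] := iA.
  apply/esym/eqP; rewrite eqEcard cV card_imset ?cA ?leqnn ?andbT; last exact: expr_frob_inj.
  apply/subsetP => _ /imsetP[x Ax ->]; case: (eqVneq x 0) => [->|x0].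
    by rewrite expr0n expn_eq0.
  have [|] := H x; first by rewrite in_setD1 x0.
  by rewrite k1 mul1r => /setD1P[].
exists r, t; split=> //; rewrite eM er -em.
by apply/matrixP => a b; case: (ord3P a) => ->; case: (ord3P b) => ->; rewrite !mxE //= ?mulr1 ?mulr0.
Qed.

(** Only t^2 + t enters the equations, so both bits are allowed; the entry m changes the slope
    u^(2^i) into v. *)
Lemma nf_iso_frob i A u (v : F) t : t = 0 \/ t = 1 ->
  act (nf_mx t ((u ^+ (2 ^ i) + v) ^+ 64), sg i) (nfarc A u) = nfarc (frob i A) v.
Proof.
move=> tb; have t0 : t ^+ 2 + t = 0 by case: tb => ->; rewrite ?expr0n ?expr1n ?addxx ?addr0.
apply: (@transf i (A :\ 0) (frob i A :\ 0) (nf u) (nf v) (fun l => l ^+ (2 ^ i))).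
- by rewrite mulr1 mul0r addr0 oner_neq0.
- exact: oner_neq0.
- apply/setP => x; rewrite in_setD1; apply/imsetP/andP => [[l]|[x0 /imsetP[l Al ex]]].
    by move=> /setD1P[l0 Al] ->; rewrite mem_frob Al expf_eq0 negb_and l0 orbT.
  by exists l; rewrite // in_setD1 Al andbT; apply: contraNneq x0 => l0; rewrite ex l0 expr0n expn_eq0.
move=> l _; rewrite /qf /alpha /beta /lam /= sqrtK mulr1 mul0r addr0 !mul1r !expr1n.
split; rewrite ?expr0n /=; [by ring | | by ring].
rewrite !(frobD i) expr1n exprMn [l ^+ 3 ^+ _]exprAC.
move: (l ^+ _) (u ^+ _) => x y.
transitivity (1 + y * x + x ^+ 3 + (t ^+ 2 + t)); last by rewrite t0 addr0.
by ring2.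
Qed.

Lemma nf_isoE A u V (v : F) : isot A -> isot V ->
  isomorphic (nfarc A u) (nfarc V v) = [exists i : 'I_7, V == frob i A].
Proof.
move=> iA iV; apply/isoP/existsP => [[p vp]|[i /eqP->]].
  have [i hi ep] := valid_sg vp; rewrite ep in vp *.
  by case/(nf_iso_shape vp iA iV) => -> _; exists (Ordinal hi).
exists (nf_mx 0 ((u ^+ (2 ^ i) + v) ^+ 64), sg i); first by rewrite valid_mk ?nf_mx_unit.
by rewrite nf_iso_frob //; left.
Qed.

(** * Automorphism groups of the normal forms *)

Lemma sl_nf_mx i t m y : sl (nf_mx t m, sg i) (vc 1 y 0) = vc 1 (y ^+ (2 ^ i) + t) m.
Proof.
apply: vec_eq; rewrite slE /= !ffunE !mxE /= expr1n expr0n expn_eq0 /=; by ring.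
Qed.

(** The image of (1, y, 0) has first coordinate 1 and thus determines y^(2^i) + b. The value y = 0
    reveals b, and a y outside GF(2) reveals i because its seven conjugates are distinct. *)
Lemma pgl_nf_inj (i j : 'I_7) (b c : bool) m n :
  pgl_of (nf_mx b%:R m, sg i) = pgl_of (nf_mx c%:R n, sg j) -> i = j /\ b = c.
Proof.
move=> e.
have key y : y ^+ (2 ^ i) + b%:R = y ^+ (2 ^ j) + c%:R.
  have /(congr1 (fun f : {ffun {set vec F} -> {set vec F}} => f (pt_of (vc 1 y 0)))) := e.
  have v0 : vc 1 y 0 != 0 by rewrite vec_eq0 !mxE /= oner_eq0.
  rewrite !pgl_pt ?valid_mk ?nf_mx_unit // => ept.
  have : vc 1 (y ^+ (2 ^ i) + b%:R) m \in pt_of (vc 1 (y ^+ (2 ^ j) + c%:R) n).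
    by rewrite -!sl_nf_mx -ept; apply/mem_pt; exists 1; rewrite ?oner_neq0 ?scale1r.
  case/mem_pt => d _ /rowP ed; have := ed i0; have := ed i1; rewrite !mxE /= mulr1.
  by move=> + d1; rewrite -d1 mul1r.
have bc : b = c.
  have := key 0; rewrite !expr0n !expn_eq0 /= !add0r.
  by case: b c {e key} => -[] // /eqP; rewrite ?oner_eq0 // eq_sym oner_eq0.
split=> //; have [y y2] : exists y, y ^+ 2 != y.
  have [|y _] := @out_of_card (sp1 1) setT.
    by rewrite card_sp1 ?oner_neq0 // cardsT hF.
  rewrite !inE addx_eq0 negb_or => /andP[y0 y1]; exists y.
  by apply: contra y1 => /eqP/bit_of_sqr[/eqP|->]; rewrite ?(negPf y0).
apply: (@frob_eq i j [set y]).
  by rewrite /frob imset_set1 (inj_eq set1_inj).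
by rewrite /frob !imset_set1; have := key y; rewrite bc => /addIr ->.
Qed.

(** By [nf_iso_shape] an automorphism is, up to the scalar r, given by a Frobenius power stabilizing
    A and a bit t. *)
Lemma card_aut_nf A u : isot A ->
  #|aut_group (nfarc A u)| = (#|[set i : 'I_7 | frob i A == A]| * 2)%N.
Proof.
move=> iA.
pose G (x : 'I_7 * bool) := pgl_of (nf_mx x.2%:R ((u ^+ (2 ^ x.1) + u) ^+ 64), sg x.1).
have G_inj : injective G by move=> [i b] [j c] /pgl_nf_inj /= [-> ->].
transitivity #|G @: setX [set i : 'I_7 | frob i A == A] [set: bool]|; last first.
  by rewrite card_imset // cardsX cardsT card_bool.
apply: eq_card => f; apply/imsetP/imsetP => [[p]|[[i b]]].
  rewrite inE => /andP[vp /eqP ep] ->; have [i hi eqp] := valid_sg vp.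
  rewrite eqp in vp ep *; have [eA [r [t [r0 tb eM]]]] := nf_iso_shape vp iA iA ep.
  have [b tE] : exists b : bool, t = b%:R by case: tb => ->; [exists false | exists true].
  exists (Ordinal hi, b); first by rewrite !inE /= -eA eqxx.
  apply: pgl_ext => //; first by rewrite valid_mk ?nf_mx_unit.
  by move=> v; exists r; rewrite // !sl_sg eM /= tE -scalemxAr.
rewrite !inE /= andbT => /eqP eA ->; exists (nf_mx b%:R ((u ^+ (2 ^ i) + u) ^+ 64), sg i) => //.
rewrite inE valid_mk ?nf_mx_unit // nf_iso_frob ?eA ?eqxx //.
by case: b; [right | left].
Qed.

Lemma stab_frob A : isot A ->
  #|[set i : 'I_7 | frob i A == A]| = if frob 1 A == A then 7%N else 1%N.
Proof.
move=> iA; case: eqP => [fA|/eqP fA].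
  have h i : frob i A = A by elim: i => [|i IH]; rewrite ?frob0 // -addn1 -frobM IH.
  have -> : [set i : 'I_7 | frob i A == A] = setT by apply/setP => i; rewrite !inE h eqxx.
  by rewrite cardsT card_ord.
have -> : [set i : 'I_7 | frob i A == A] = [set ord0].
  apply/setP => i; rewrite !inE; apply/eqP/eqP => [e|->]; last exact: frob0.
  by apply: (frob_eq fA); rewrite e frob0.
exact: cards1.
Qed.

(** * Reduction of proper Mathon arcs to normal forms, and the final count *)

Lemma linear_form p : valid p -> exists2 l : vec F, l != 0 &
  forall v, (dotv (sl p v) l == 0) = (v 0 i0 == 0).
Proof.
move=> vp; have [i _ ep] := valid_sg vp; case/andP: vp => Mp _.
(* The first column of the inverse matrix: coordinates of the image of the line x = 0. *)
pose l : vec F := \row_j invmx p.1 j i0.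
have dE v : dotv (sl p v) l = v 0 i0 ^+ (2 ^ i).
  have : (sl p v *m invmx p.1) 0 i0 = v 0 i0 ^+ (2 ^ i).
    by rewrite ep sl_sg /= -mulmxA mulmxV // mulmx1 mxE.
  by rewrite mxE => <-; apply: eq_bigr => j _; rewrite [l 0 j]mxE.
exists l; last by move=> v; rewrite dE expf_eq0 expn_gt0.
apply/eqP => l0; have := dE (vc 1 0 0); rewrite l0 mxE /= expr1n /dotv big1.
  by move/eqP; rewrite eq_sym oner_eq0.
by move=> j _; rewrite [X in _ * X]mxE mulr0.
Qed.

(** The image of the line x = 0 meets the arc in #|C| + 1 points, which is not zero and so equals
    the degree 8. *)
Lemma maxarc_card C p : mathon_set 7 C -> valid p ->
  is_maxarc 8 (act p (mathon_arc C)) -> #|C| = 7%N.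
Proof.
move=> mC vp /and4P[_ _ _ /forall_inP H].
have [l l0 hl] := linear_form vp.
have := H l l0; rewrite hF -[(2 ^ 7 - 1)%N]/127%N.
have -> : [set x in act p (mathon_arc C) | dotv x l == 0] =
    act p [set v in mathon_arc C | v 0 i0 == 0].
  apply/setP => w; rewrite in_set; apply/andP/imsetP => [[/imsetP[v Cv ->]]|[v]].
    by rewrite -/(sl p v) hl => v0; exists v; rewrite // in_set Cv.
  by rewrite in_set => /andP[Cv v0] ->; rewrite -/(sl p v) mem_act // hl.
rewrite /= card_imset; last exact: sl_inj.
by rewrite card_arc_axis // muln_eq0 /= eqn_pmul2r // eqSS => /eqP.
Qed.

(** By [nf_rigid], a Denniston arc isomorphic to this one would make a polynomial with cubic
    coefficient 1 agree with a constant at seven points. *)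
Lemma nf_not_denniston A u : isot A -> {in A, forall l, tr (l ^+ 3 + u * l) = 0} ->
  ~~ denniston_type 7 (nfarc A u).
Proof.
move=> iA tA; apply/negP => /existsP[C /existsP[a /and4P[mC _ /forall_inP hC /existsP[p /andP[vp /eqP e]]]]].
have [_ l0 linj _] := mathonP mC.
have cC : #|C| = 7%N by apply: (maxarc_card mC vp); rewrite e; exact: nf_maxarc.
have eC : C = (fun l => ((a, 1), l) : triple F) @: [set lam c | c in C].
  rewrite -imset_comp -[LHS]imset_id; apply: eq_in_imset => c /hC /andP[/eqP ha /eqP hb] /=.
  by case: c ha hb => -[x y] z /= <- <-.
have [i hi ep] := valid_sg vp; rewrite ep in vp e; rewrite eC in e.
have cT : #|[set lam c | c in C]| = 7%N by rewrite card_in_imset.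
have [||r [t [m [k [r0 k0 _ _ H]]]]] := nf_rigid (f := fun=> a) vp _ _ iA e.
- by rewrite cT.
- by apply/imsetP => -[c /l0 + ec]; rewrite -ec eqxx.
have [|_ /imsetP[l Tl ->]|_ _ _ c3 _] := @quartic0 [set k * l ^+ (2 ^ i) | l in [set lam c | c in C]]
   (1 + t ^+ 2 + t + a ^+ (2 ^ i)) (u + m ^+ 2) 0 1 0.
- by apply: gt4_card => [x y /(mulfI k0)|]; [exact: expr_frob_inj | rewrite cT].
- have [_] := H l Tl; move: (k * _) => x hx.
  by rewrite -[RHS](addxx (a ^+ (2 ^ i))) [X in _ = X + _]hx; ring2.
by move/eqP: c3; rewrite oner_eq0.
Qed.

(** On an isotropic A the map Tr(x^3) is additive, hence linearized. Applying Tr once more changes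
    nothing, as Tr(1) = 1, and lets the terms in x^2 and x^4 be moved to x. *)
Lemma isot_trace_linear A : isot A -> exists u, {in A, forall l, tr (l ^+ 3 + u * l) = 0}.
Proof.
case/isotP => sA cA hA.
have [|c0 [c1 [c2 hc]]] := linearized (f := fun x => tr (x ^+ 3)) sA cA.
  by move=> x y Ax Ay; rewrite tr_cubeD hA // addr0.
exists (c0 + c1 ^+ 64 + c2 ^+ 32) => l Al.
have trK x : tr (tr x) = tr x by case: (tr_bit x) => ->; rewrite ?tr0 ?tr1.
rewrite trD -(trK (l ^+ 3)) hc // /lin !trD !mulrDl !trD.
have -> : tr (c1 ^+ 64 * l) = tr (c1 * l ^+ 2) by rewrite -[LHS]tr_sqr exprMn sqrtK.
have -> : tr (c2 ^+ 32 * l) = tr (c2 * l ^+ 4).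
  by rewrite -[in RHS](expr128 c2) -[LHS]tr_sqr -[LHS]tr_sqr; congr (tr _); ring.
exact: addxx.
Qed.

(** The default 0 is returned only if no suitable u exists, which does not happen for isotropic
    A. *)
Definition slope A := odflt 0 [pick u | [forall l in A, tr (l ^+ 3 + u * l) == 0]].

Lemma slopeP A : isot A -> {in A, forall l, tr (l ^+ 3 + slope A * l) = 0}.
Proof.
move=> /isot_trace_linear[u hu]; rewrite /slope; case: pickP => [w /forall_inP hw l /hw /eqP //|].
by move/(_ u)/negP; case; apply/forall_inP => l /hu ->.
Qed.

Definition narc A := nfarc A (slope A).

Lemma narc_proper A : isot A -> proper_mathon_arc 7 8 (narc A).
Proof.
move=> iA; have tA := slopeP iA; apply/and3P; split; last exact: nf_not_denniston.
  exact: nf_maxarc.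
apply/existsP; exists (nfset A (slope A)); rewrite mathon_nf //=.
exact: (iso_refl (narc A)).
Qed.

(** After normalizing the constant terms, either a cubic coefficient is nonzero and [normalize_cube]
    applies, or the arc is isomorphic to one with alpha = beta = 1, contradicting properness. *)
Lemma proper_narc S : proper_mathon_arc 7 8 S -> exists2 A, isot A & isomorphic S (narc A).
Proof.
case/and3P => mS /existsP[C /andP[mC /existsP[p /andP[vp /eqP eS]]]] nd.
have cC : #|C| = 7%N by apply: (maxarc_card mC vp); rewrite eS.
have isoS : isomorphic S (mathon_arc C) by apply/iso_sym/isoP; exists p.
have [A [a0 [a1 [a2 [b0 [b1 [b2 [sA cA eC h]]]]]]]] := mathon_param mC cC.
have [c1 [c2 [d1 [d2 [iso1 h1]]]]] := normalize_const sA cA h.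
rewrite eC in isoS; have {iso1} iso1 := iso_trans isoS iso1.
case: (boolP ((c2 != 0) || (d2 != 0))) => [cd|].
  have [V [u [iV tV iso2]]] := normalize_cube sA cA cd h1.
  exists V => //; apply: iso_trans (iso_trans iso1 iso2) _.
  (* The slope u found here may differ from [slope V]; the trivial Frobenius power links the two
     arcs. *)
  by rewrite nf_isoE //; apply/existsP; exists ord0; rewrite frob0.
rewrite negb_or !negbK => /andP[/eqP c20 /eqP d20]; rewrite c20 d20 in iso1.
have /iso_sym/isoP[q vq eq] := iso_trans iso1 (normalize_denniston A c1 d1).
case/negP: nd; apply/existsP; exists ((fun l => ((1, 1), l) : triple F) @: (A :\ 0)).
apply/existsP; exists 1; apply/and4P; split.
- by apply: (@mathon_set_image A (fun=> 1)) => // [l _|x y _ _]; rewrite ?tr1 // !mul1r.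
- by rewrite tr1.
- by apply/forall_inP => _ /imsetP[l _ ->]; rewrite eqxx.
by apply/existsP; exists q; rewrite vq eq eqxx.
Qed.

Lemma classification :
  let P := [set S : {set 'rV[F]_3} | proper_mathon_arc 7 8 S] in
  [/\ #|iso_classes P| = 201%N, #|iso_classes_with P 14| = 2%N &
      #|iso_classes_with P 2| = 199%N].
Proof.
move=> P; pose g A := [set T in P | isomorphic (narc A) T].
have memP A : isot A -> narc A \in P by move=> iA; rewrite inE narc_proper.
have gE : {in isots &, forall A V, (g A == g V) = [exists i : 'I_7, V == frob i A]}.
  move=> A V; rewrite !inE => iA iV; rewrite -(nf_isoE (slope A) (slope V)) //.
  apply/eqP/idP => [/setP/(_ (narc V))|iso]; first by rewrite !inE !narc_proper // iso_refl.
  apply/setP => T; rewrite !in_set; congr (_ && _); apply/idP/idP; apply: iso_trans => //.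
  exact: iso_sym.
have class_g S A : isomorphic S (narc A) -> [set T in P | isomorphic S T] = g A.
  move=> iso; apply/setP => T; rewrite !in_set; congr (_ && _).
  by apply/idP/idP; apply: iso_trans => //; exact: iso_sym.
have [c c2 c199] := card_classes gE.
have autE A : isot A -> #|aut_group (narc A)| = if frob 1 A == A then 14%N else 2%N.
  by move=> iA; rewrite card_aut_nf // stab_frob //; case: ifP.
(* The order of the automorphism group is an isomorphism invariant, so it can be read off the
   representative [narc A] of each class. *)
have classes_with (n : nat) (X : {set {set F}}) : X \subset isots ->
    {in isots, forall A, (#|aut_group (narc A)| == n) = (A \in X)} ->
    iso_classes_with P n = g @: X.
  move=> sX hX; apply/setP => K; apply/imsetP/imsetP => [[S]|[A XA ->]].
    rewrite inE => /andP[]; rewrite inE => /proper_narc[A iA iso] autS ->.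
    by exists A; rewrite -?hX ?inE ?(class_g _ _ iso) -?(card_aut_iso iso).
  have iA := subsetP sX A XA; exists (narc A) => //; rewrite inE hX ?XA ?andbT //.
  by apply: memP; move: iA; rewrite inE.
split.
- rewrite -[RHS]c; congr #|pred_of_set _|; apply/setP => K; apply/imsetP/imsetP => [[S]|[A]].
    by rewrite inE => /proper_narc[A iA iso] ->; exists A; rewrite ?inE ?(class_g _ _ iso).
  by rewrite inE => iA ->; exists (narc A); rewrite ?memP.
- rewrite -[RHS]c2 (classes_with _ fisots) //; first by apply/subsetP => A; rewrite inE => /andP[].
  by move=> A; rewrite !inE => iA; rewrite autE // iA; case: (_ == A).
rewrite -[RHS]c199 (classes_with _ (isots :\: fisots)) ?subsetDl //.
by move=> A; rewrite !inE => iA; rewrite autE // iA andbT; case: (_ == A).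
Qed.

End Classification.

Theorem theorem4 (F : finFieldType) (hF : #|F| = (2 ^ 7)%N) :
  let P := [set S : {set 'rV[F]_3} | proper_mathon_arc 7 8 S] in
  [/\ #|iso_classes P| = 201%N,
      #|iso_classes_with P 14| = 2%N &
      #|iso_classes_with P 2| = 199%N].
Proof. exact: classification. Qed.
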